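(* Let $n,k,l\in\mathbb{N}$ with $n\geq k\geq l$, and let $X$ be a compact Hausdorff space with $\left\lfloor \frac{\dim X}{2}\right\rfloor \leq k-l$. Then there is only one homotopy class of continuous functions $f:X\to S(n,k,l)$; i.e. the function space $C(X,S(n,k,l))$ is path connected.
   Context: $\mathbb{N}$ denotes the positive integers. For $n\geq k\geq l$ in $\mathbb{N}$, $S(n,k,l)=\{b\in M_n(\mathbb{C}) : b \text{ is non-negative definite and } l\leq \operatorname{rank}(b)\leq k\}$, with the subspace topology induced by the norm topology of $M_n(\mathbb{C})$. $\dim X$ is the covering dimension of $X$ (finite here, by the hypothesis). $C(X,S(n,k,l))$ is the set of continuous maps $X\to S(n,k,l)$, viewed as a subset of $C(X,M_n(\mathbb{C}))$ with the supremum norm topology; a path in it is the same as a homotopy $X\times[0,1]\to S(n,k,l)$. *)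

(* Defs.v *)
From HB Require Import structures.
From mathcomp Require Import all_boot all_order all_algebra.
From mathcomp Require Import all_classical all_reals all_analysis.
From mathcomp Require Import complex.

Set Implicit Arguments.
Unset Strict Implicit.
Unset Printing Implicit Defensive.

Import Order.TTheory GRing.Theory Num.Theory.
Import numFieldNormedType.Exports.

Local Open Scope classical_set_scope.
Local Open Scope ring_scope.
Local Open Scope sesquilinear_scope.

(* Naming the codomain [numClosedFieldType] lets [R[i]] inherit the topology
   that every [numFieldType] carries (the one given by the modulus), and
   ['M[Cplx R]_n] the corresponding entrywise topology, which is the topology of
   any norm on n x n matrices. *)
Definition Cplx (R : realType) : numClosedFieldType := R[i].

Section CoveringDimension.
Variable X : topologicalType.

(* Covers are indexed families; the order of the family [V] at [x] is the number
   of indices [j] with [x] in [V j]. *)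
Definition covering_dim_le (d : int) : Prop :=
  forall (p : nat) (U : 'I_p -> set X),
    (forall i, open (U i)) -> \bigcup_i U i = [set: X] ->
  exists (q : nat) (V : 'I_q -> set X),
    [/\ forall j, open (V j),
        \bigcup_j V j = [set: X],
        forall j, exists i, V j `<=` U i
      & forall x, #|[pred j | x \in V j]|%:Z <= d + 1].

(* With the lower bound -1, the empty space is the one of dimension -1. No [d]
   satisfies this when the dimension is infinite. *)
Definition covering_dim (d : int) : Prop :=
  [/\ -1 <= d,
      covering_dim_le d
    & forall e : int, -1 <= e -> e < d -> ~ covering_dim_le e].

End CoveringDimension.

(* Over [Cplx R], [0 <= z] says that [z] is real and nonnegative. *)
Definition nonneg_definite (R : realType) (n : nat) (b : 'M[Cplx R]_n) : Prop :=
  b \is hermsymmx /\ forall u : 'rV[Cplx R]_n, 0 <= (u *m b *m u ^t*) 0 0.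

Definition Snkl (R : realType) (n k l : nat) : set 'M[Cplx R]_n :=
  [set b | nonneg_definite b /\ (l <= \rank b <= k)%N].
Arguments Snkl : clear implicits.

(* Uniform convergence is the topology of the supremum norm. *)
Definition continuous_maps (X : topologicalType) (Y : puniformType)
    (S : set Y) : set {uniform X -> Y} :=
  [set f | continuous (f : X -> Y) /\ forall x, S (f x)].

Definition homotopic_in (R : realType) (X Y : topologicalType) (S : set Y)
    (f g : X -> Y) : Prop :=
  exists H : X * R -> Y,
    [/\ {within [set: X] `*` `[0, 1], continuous H},
        forall x t, t \in `[0, 1] -> S (H (x, t)),
        forall x, H (x, 0) = f x
      & forall x, H (x, 1) = g x].

Definition path_connected (R : realType) (T : topologicalType) (A : set T)
    : Prop :=
  A !=set0 /\
  forall f g, A f -> A g ->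
  exists c : R -> T,
    [/\ {within `[0, 1], continuous c},
        forall t, t \in `[0, 1] -> A (c t),
        c 0 = f
      & c 1 = g].

(* Main.v *)
Require Import Defs.
From HB Require Import structures.
From mathcomp Require Import all_boot all_order all_algebra.
From mathcomp Require Import all_classical all_reals all_analysis.
From mathcomp Require Import complex.
From mathcomp Require Import zify ring lra.

Set Implicit Arguments.
Unset Strict Implicit.
Unset Printing Implicit Defensive.

Import Order.TTheory GRing.Theory Num.Theory.
Import numFieldNormedType.Exports.

Local Open Scope classical_set_scope.
Local Open Scope ring_scope.

(** The map [f] is first deformed to a map [ft] into the same space whose image
    is contained in a finite union of Lipschitz images of simplices: average the
    values of [f] with a partition of unity subordinate to a fine cover of order
    at most [2m], where [m = k - l + 1], subtract a small scalar matrix, and take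
    the positive part.  The subtraction makes the result lie below [f] in the
    Loewner order before the positive part is taken, which bounds the rank by
    [k]; the positive part is 1-Lipschitz for the Frobenius norm, which keeps
    the rank at least [l] and makes the image finite-dimensional.

    A generic constant [M : 'M_(n, k)] then satisfies [\rank (ft x *m M) >= l]
    for all [x]: this fails only if [v *m M = 0] for some [v = u *m A *m ft x]
    with [u] in [C^l] having a coordinate [1] and [A] in a finite list of
    [l x n] matrices; such [v] depend on [2m - 1 + 2(l - 1) = 2k - 1] real
    parameters and stay away from [0], whereas [v *m M = 0] imposes [2k] real
    conditions on [M].

    Finally [ft] is joined to [ft M M^* ft] by a segment and then to the constant
    [M M^*] through [B_t M M^* B_t] with [B_t = (1 - t) ft + t], which is
    invertible for [t > 0].  The same [M] serves for two given maps. *)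

(** * Nonnegative matrices and positive parts *)

(** Rank-nullity for left kernels. Most rank comparisons below reduce to such an inclusion of
    kernels. *)
Lemma rank_le_ker (F : fieldType) m n p (A : 'M[F]_(m, n)) (B : 'M[F]_(m, p)) :
  (forall u : 'rV_m, u *m B = 0 -> u *m A = 0) -> (\rank A <= \rank B)%N.
Proof.
move=> h; have /mxrankS : (kermx B <= kermx A)%MS.
  by apply/rV_subP => u /sub_kermxP /h uA; apply/sub_kermxP.
by rewrite !mxrank_ker leq_sub2lE // rank_leq_row.
Qed.

Lemma tr_sqrB (F : comNzRingType) n (K L : 'M[F]_n) :
  \tr ((K - L) *m (K - L)) =
  \tr (K *m K) - \tr (K *m L) - \tr (L *m K) + \tr (L *m L).
Proof. by rewrite mulmxBr !mulmxBl !linearB /=; ring. Qed.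

Section NonnegativeMatrices.
Local Open Scope sesquilinear_scope.
Variable R : realType.
Local Notation C := (Cplx R).

Lemma ctmxM m n p (A : 'M[C]_(m, n)) (B : 'M[C]_(n, p)) :
  (A *m B)^t* = B^t* *m A^t*.
Proof. by rewrite trmx_mul map_mxM. Qed.

Lemma ctmxD m n (A B : 'M[C]_(m, n)) : (A + B)^t* = A^t* + B^t*.
Proof. by rewrite linearD /= map_mxD. Qed.

Lemma ctmxB m n (A B : 'M[C]_(m, n)) : (A - B)^t* = A^t* - B^t*.
Proof. by rewrite linearB /= map_mxB. Qed.

Lemma ctmxZ m n (a : C) (A : 'M[C]_(m, n)) : (a *: A)^t* = a^* *: A^t*.
Proof. by rewrite linearZ /= map_mxZ. Qed.

Lemma hermsymP n (A : 'M[C]_n) : reflect (A^t* = A) (A \is hermsymmx).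
Proof.
by apply: (iffP (is_hermitianmxP _ _ A)); rewrite expr0 scale1r => /esym.
Qed.

Lemma dot_mxE m n (A B : 'M[C]_(m, n)) i j :
  (A *m B^t*) i j = \sum_k A i k * (B j k)^*.
Proof. by rewrite mxE; apply: eq_bigr => k _; rewrite !mxE. Qed.

Lemma dot_ge0 n (u : 'rV[C]_n) : 0 <= (u *m u^t*) 0 0.
Proof. by rewrite dot_mxE sumr_ge0 // => k _; rewrite mul_conjC_ge0. Qed.

Lemma dot_eq0 n (u : 'rV[C]_n) : (u *m u^t*) 0 0 = 0 -> u = 0.
Proof.
rewrite dot_mxE => /eqP; rewrite psumr_eq0 => [/allP h|k _]; last first.
  by rewrite mul_conjC_ge0.
apply/rowP => k; rewrite mxE; apply/eqP; rewrite -mul_conjC_eq0.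
exact: (implyP (h k (mem_index_enum k))).
Qed.

Lemma quad_gram n p (S : 'M[C]_(n, p)) (u : 'rV[C]_n) :
  u *m (S *m S^t*) *m u^t* = (u *m S) *m (u *m S)^t*.
Proof. by rewrite ctmxM !mulmxA. Qed.

Lemma gram_nonneg n p (S : 'M[C]_(n, p)) : nonneg_definite (S *m S^t*).
Proof.
split; first by apply/hermsymP; rewrite ctmxM trmxCK.
by move=> u; rewrite quad_gram dot_ge0.
Qed.

Lemma hermsym_spectral n (A : 'M[C]_n) : A \is hermsymmx ->
  exists (U : 'M[C]_n) (D : 'rV[C]_n),
    [/\ U \is unitarymx, A = U^t* *m diag_mx D *m U & forall i, D 0 i \is Num.real].
Proof.
move=> hA; have /orthomx_spectralP eA := hermitian_normalmx hA.
exists (spectralmx A), (spectral_diag A); split.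
- exact: spectral_unitarymx.
- by rewrite {1}eA invmx_unitary ?spectral_unitarymx.
- by move=> i; apply: (mxOverP (hermitian_spectral_diag_real hA)).
Qed.

Lemma diag_gram n (D : 'rV[C]_n) (U : 'M[C]_n) : (forall i, 0 <= D 0 i) ->
  let S := U^t* *m diag_mx (map_mx sqrtC D) in U^t* *m diag_mx D *m U = S *m S^t*.
Proof.
move=> D0 /=; rewrite ctmxM trmxCK !mulmxA; congr (_ *m _).
rewrite -!mulmxA; congr (_ *m _).
rewrite tr_diag_mx map_diag_mx mulmx_diag; congr diag_mx; apply/rowP => i.
rewrite !mxE /= (CrealP _) ?ger0_real ?sqrtC_ge0 //.
by rewrite -expr2 sqrtCK.
Qed.

Lemma nonneg_diag n (D : 'rV[C]_n) (U : 'M[C]_n) : (forall i, 0 <= D 0 i) ->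
  nonneg_definite (U^t* *m diag_mx D *m U).
Proof. by move=> D0; rewrite diag_gram //; apply: gram_nonneg. Qed.

(** The quadratic form at the [k]-th row of [U] has the value [D 0 k]. *)
Lemma diag_nonneg n (D : 'rV[C]_n) (U : 'M[C]_n) : U \is unitarymx ->
  nonneg_definite (U^t* *m diag_mx D *m U) -> forall i, 0 <= D 0 i.
Proof.
move=> /unitarymxP Uu [_ P0] k; have := P0 (delta_mx 0 k *m U).
rewrite ctmxM !mulmxA -(mulmxA _ U) Uu mulmx1 -(mulmxA _ U) Uu mulmx1.
rewrite -rowE trmx_delta map_delta_mx.
by rewrite -colE !mxE eqxx.
Qed.

Lemma nonneg_factor n (P : 'M[C]_n) :
  nonneg_definite P -> exists S : 'M[C]_n, P = S *m S^t*.
Proof.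
move=> hP; have [U [D [Uu eP _]]] := hermsym_spectral hP.1.
have D0 : forall i, 0 <= D 0 i by apply: (diag_nonneg Uu); rewrite -eP.
by exists (U^t* *m diag_mx (map_mx sqrtC D)); rewrite -diag_gram.
Qed.

Lemma nonneg_ker n (P : 'M[C]_n) (u : 'rV[C]_n) :
  nonneg_definite P -> (u *m P *m u^t*) 0 0 = 0 -> u *m P = 0.
Proof.
by case/nonneg_factor => S ->; rewrite quad_gram => /dot_eq0 uS; rewrite mulmxA uS mul0mx.
Qed.

Lemma nonnegD n (P Q : 'M[C]_n) :
  nonneg_definite P -> nonneg_definite Q -> nonneg_definite (P + Q).
Proof.
move=> [/hermsymP hP P0] [/hermsymP hQ Q0]; split.
  by apply/hermsymP; rewrite ctmxD hP hQ.
by move=> u; rewrite mulmxDr mulmxDl mxE addr_ge0.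
Qed.

Lemma nonnegZ n (a : C) (P : 'M[C]_n) :
  0 <= a -> nonneg_definite P -> nonneg_definite (a *: P).
Proof.
move=> a0 [/hermsymP hP P0]; split.
  by apply/hermsymP; rewrite ctmxZ hP (CrealP _) ?ger0_real.
by move=> u; rewrite -scalemxAr -scalemxAl mxE mulr_ge0.
Qed.

Lemma nonneg1 n : nonneg_definite (1%:M : 'M[C]_n).
Proof. by have := gram_nonneg (1%:M : 'M[C]_n); rewrite mul1mx trmx1 map_mx1. Qed.

Lemma rank_gram n p (S : 'M[C]_(n, p)) : \rank (S *m S^t*) = \rank S.
Proof.
apply/eqP; rewrite eqn_leq mxrankM_maxl /=; apply: rank_le_ker => u h.
by apply: dot_eq0; rewrite -quad_gram h mul0mx mxE.
Qed.

(** The forms of [P] and [Q] at [u] are nonnegative with sum [0], so both vanish, and [nonneg_ker]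
    applies. *)
Lemma nonneg_kerD n (P Q : 'M[C]_n) (u : 'rV[C]_n) :
  nonneg_definite P -> nonneg_definite Q -> u *m (P + Q) = 0 -> u *m P = 0.
Proof.
move=> hP hQ h; apply: nonneg_ker => //.
have: (u *m (P + Q) *m u^t*) 0 0 = 0 by rewrite h mul0mx mxE.
rewrite mulmxDr mulmxDl mxE => /eqP; rewrite paddr_eq0 ?hP.2 ?hQ.2 //.
by case/andP => /eqP.
Qed.

Lemma rankD_nonneg n (P Q : 'M[C]_n) :
  nonneg_definite P -> nonneg_definite Q -> (\rank P <= \rank (P + Q)%R)%N.
Proof. by move=> hP hQ; apply: rank_le_ker => u; apply: nonneg_kerD. Qed.

(** The squared Frobenius norm, kept in [C] so that it compares directly with traces. *)
Definition sqnorm m n (A : 'M[C]_(m, n)) : C := \sum_i \sum_j `|A i j| ^+ 2.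

Lemma sqnorm_ge0 m n (A : 'M[C]_(m, n)) : 0 <= sqnorm A.
Proof. by rewrite !sumr_ge0 // => i _; rewrite sumr_ge0 // => j _; rewrite exprn_ge0. Qed.

Lemma trM_gram m n (A : 'M[C]_(m, n)) : \tr (A *m A^t*) = sqnorm A.
Proof.
apply: eq_bigr => i _; rewrite dot_mxE; apply: eq_bigr => j _.
by rewrite normCK.
Qed.

(** Writing [P] and [Q] as Gram matrices of [S] and [T], the trace is the squared Frobenius norm of
    [T^t* *m S]. *)
Lemma trM_nonneg n (P Q : 'M[C]_n) :
  nonneg_definite P -> nonneg_definite Q -> 0 <= \tr (P *m Q).
Proof.
move=> /nonneg_factor[S ->] /nonneg_factor[T ->].
rewrite mulmxA mxtrace_mulC !mulmxA -mulmxA.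
have <- : (T^t* *m S)^t* = S^t* *m T by rewrite ctmxM trmxCK.
by rewrite trM_gram sqnorm_ge0.
Qed.

(* [P] and [P - A] are the positive and negative parts of [A]. *)
Definition pos_part_of n (A P : 'M[C]_n) : Prop :=
  [/\ nonneg_definite P, nonneg_definite (P - A) & P *m (P - A) = 0].

Lemma pos_part_ex n (A : 'M[C]_n) : A \is hermsymmx -> exists P, pos_part_of A P.
Proof.
move=> /hermsym_spectral[U [D [Uu eA Dr]]].
pose E : 'rV[C]_n := \row_i (if 0 <= D 0 i then D 0 i else 0).
have E0 i : 0 <= E 0 i by rewrite mxE; case: ifP.
have ED i : 0 <= (E - D) 0 i.
  rewrite !mxE; case: ifPn; first by rewrite subrr.
  by rewrite -real_ltNge ?real0 ?Dr // sub0r oppr_ge0 => /ltW.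
exists (U^t* *m diag_mx E *m U); rewrite /pos_part_of.
have -> : U^t* *m diag_mx E *m U - A = U^t* *m diag_mx (E - D) *m U.
  by rewrite eA linearB mulmxBr mulmxBl.
split; [exact: nonneg_diag | exact: nonneg_diag |].
rewrite !mulmxA -(mulmxA _ U) (unitarymxP Uu) mulmx1 -(mulmxA _ (diag_mx E)).
rewrite mulmx_diag (_ : diag_mx _ = 0) ?mulmx0 ?mul0mx //.
apply/matrixP => i j; rewrite !mxE; case: (_ == _); rewrite ?mulr0n // mulr1n.
by case: ifP => _; rewrite ?subrr ?mulr0 ?mul0r.
Qed.

Lemma pos_part_id n (A : 'M[C]_n) : nonneg_definite A -> pos_part_of A A.
Proof.
move=> hA; rewrite /pos_part_of subrr mulmx0; split; [exact: hA| |reflexivity].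
by have := gram_nonneg (0 : 'M[C]_n); rewrite mul0mx.
Qed.

(* The positive part is the metric projection onto the cone of nonnegative
   matrices for the Frobenius norm, hence it is nonexpansive. *)
Lemma nonneg_diff_lip n (P N Q M : 'M[C]_n) :
  nonneg_definite P -> nonneg_definite N -> P *m N = 0 ->
  nonneg_definite Q -> nonneg_definite M -> Q *m M = 0 ->
  sqnorm (P - Q) <= sqnorm ((P - N) - (Q - M)).
Proof.
move=> hP hN PN hQ hM QM.
have eAB : (P - N) - (Q - M) = (P - Q) - (N - M).
  by apply/matrixP => i j; rewrite !mxE; ring.
have herm (X : 'M[C]_n) : nonneg_definite X -> X^t* = X by case=> /hermsymP.
(* Since [P *m N] and [Q *m M] vanish, the cross terms enter the expansion of the right-hand square
   as nonnegative traces; dropping them and the square of [N - M] gives the bound. *)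
have cross : \tr ((P - Q) *m (N - M)) = - (\tr (P *m M) + \tr (Q *m N)).
  rewrite mulmxBr !mulmxBl PN QM sub0r subr0 -opprD linearN linearD /=.
  by rewrite addrC.
have crossC : \tr ((N - M) *m (P - Q)) = - (\tr (P *m M) + \tr (Q *m N)).
  by rewrite mxtrace_mulC.
have c0 := addr_ge0 (trM_nonneg hP hM) (trM_nonneg hQ hN).
rewrite eAB -!trM_gram.
have hK : (P - Q)^t* = P - Q by rewrite ctmxB (herm P hP) (herm Q hQ).
have hL : (N - M)^t* = N - M by rewrite ctmxB (herm N hN) (herm M hM).
have := sqnorm_ge0 (N - M); rewrite -trM_gram hL.
rewrite (ctmxB (P - Q)) hK hL => LL.
rewrite (tr_sqrB (P - Q)) cross crossC -subr_ge0; move: c0 LL.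
move: (\tr _ + \tr _) (\tr ((N - M) *m _)) (\tr ((P - Q) *m _)) => c b a c0 b0.
by rewrite [leRHS](_ : _ = c + c + b) ?addr_ge0 //; ring.
Qed.

Lemma pos_part_lip n (A B P Q : 'M[C]_n) :
  pos_part_of A P -> pos_part_of B Q -> sqnorm (P - Q) <= sqnorm (A - B).
Proof.
move=> [hP hPA PA] [hQ hQB QB].
by have := nonneg_diff_lip hP hPA PA hQ hQB QB; rewrite !subKr.
Qed.

(** On a row [u = w *m P] the negative part vanishes, so the forms of [A] and [P] agree there. As
    [B] dominates [A], [u *m B = 0] makes the form of [P] vanish at [u]; then [u *m P = 0], and
    [u = 0] because [u *m u^t*] equals [u *m P *m w^t*]. *)
Lemma pos_part_rank n (A B P : 'M[C]_n) : pos_part_of A P ->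
  nonneg_definite B -> nonneg_definite (B - A) -> (\rank P <= \rank B)%N.
Proof.
move=> [hP hN PN] hB hBA; apply: leq_trans (mxrankM_maxr P B).
apply: rank_le_ker => w; rewrite mulmxA; set u := w *m P => uB.
have uN : u *m (P - A) = 0 by rewrite -mulmxA PN mulmx0.
have e : (u *m B *m u^t*) 0 0 = (u *m (B - A) *m u^t*) 0 0 + (u *m P *m u^t*) 0 0.
  suff -> : u *m B = u *m (B - A) + u *m P by rewrite mulmxDl mxE.
  rewrite -mulmxDr -[RHS]subr0 -uN -mulmxBr; congr (_ *m _).
  by rewrite opprB addrACA subrK subrr addr0.
have /eqP : (u *m P *m u^t*) 0 0 = 0.
  move: e; rewrite uB mul0mx mxE => /esym/eqP.
  by rewrite paddr_eq0 ?hBA.2 ?hP.2 // => /andP[_ /eqP].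
move=> /eqP /(nonneg_ker hP) uP; apply: dot_eq0.
by rewrite /u ctmxM (hermsymP _ hP.1) mulmxA -/u uP mul0mx mxE.
Qed.

End NonnegativeMatrices.

(** * Homotopies of matrix-valued maps *)

Lemma comp_continuous (T U V : topologicalType) (f : T -> U) (g : U -> V) :
  continuous f -> continuous g -> continuous (fun x => g (f x)).
Proof. by move=> cf cg x; apply: (@continuous_comp _ _ _ f g x (cf x) (cg _)). Qed.

Lemma pair_continuous (T U V : topologicalType) (f : T -> U) (g : T -> V) :
  continuous f -> continuous g -> continuous (fun x => (f x, g x)).
Proof. by move=> cf cg x; apply: cvg_pair; [exact: cf | exact: cg]. Qed.

Lemma fst_continuous (T U : topologicalType) : continuous (@fst T U).
Proof. by move=> x; exact: cvg_fst. Qed.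

Lemma snd_continuous (T U : topologicalType) : continuous (@snd T U).
Proof. by move=> x; exact: cvg_snd. Qed.

Lemma id_continuous (T : topologicalType) : continuous (fun x : T => x).
Proof. by move=> x; exact: cvg_id. Qed.

Section Homotopies.
Local Open Scope sesquilinear_scope.
Variable R : realType.
Local Notation C := (Cplx R).

Lemma mx_continuousP (T : topologicalType) m n (f : T -> 'M[C]_(m, n)) :
  continuous f <-> forall i j, continuous (fun x => f x i j).
Proof.
split=> [cf i j x|cf x].
  exact: (@continuous_comp _ _ _ f (fun M : 'M[C]_(m, n) => M i j) x (cf x)
    (@coord_continuous _ _ _ i j (f x))).
move=> A [P hP PA]; have h : \forall y \near x, forall i j, P i j (f y i j).
  by apply: filter_forall => i; apply: filter_forall => j; exact: (cf i j x _ (hP i j)).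
by apply: filterS h => y h; apply: PA.
Qed.

Definition emb (r : R) : C := (r%:C)%C.

Lemma emb_continuous : continuous emb.
Proof.
move=> r A /= /nbhs_ballP[e e0 eA]; have /= er := RRe_real (gtr0_real e0).
apply/nbhs_ballP; exists (complex.Re e) => /= [|y ry].
  by rewrite -ltcR er.
apply: eA; rewrite /ball /= -er /emb -rmorphB /= normc_def /= expr0n addr0.
by rewrite sqrtr_sqr ltcR.
Qed.

Lemma emb_ge0 r : (0 <= emb r) = (0 <= r).
Proof. exact: (lecR 0 r). Qed.

Lemma emb_nat (m : nat) : emb m%:R = m%:R :> C.
Proof. exact: (rmorph_nat (real_complex R)). Qed.

Lemma emb_real r : emb r \is @Num.real C.
Proof. by apply/complex_realP; exists r. Qed.

Lemma embN (x : R) : emb (- x) = - emb x :> C.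
Proof. exact: (rmorphN (real_complex R)). Qed.

Lemma embB (x y : R) : emb (x - y) = emb x - emb y :> C.
Proof. exact: (rmorphB (real_complex R)). Qed.

Lemma embM (x y : R) : emb (x * y) = emb x * emb y :> C.
Proof. exact: (rmorphM (real_complex R)). Qed.

Lemma emb1 : emb 1 = 1 :> C.
Proof. exact: (rmorph1 (real_complex R)). Qed.

Lemma emb_sum (I : finType) (F : I -> R) : emb (\sum_i F i) = \sum_i emb (F i) :> C.
Proof. exact: (rmorph_sum (real_complex R)). Qed.

Lemma hermsymD n (A B : 'M[C]_n) : A \is hermsymmx -> B \is hermsymmx -> A + B \is hermsymmx.
Proof. by move=> /hermsymP hA /hermsymP hB; apply/hermsymP; rewrite ctmxD hA hB. Qed.

Lemma hermsymZ n (r : R) (A : 'M[C]_n) : A \is hermsymmx -> emb r *: A \is hermsymmx.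
Proof.
by move=> /hermsymP hA; apply/hermsymP; rewrite ctmxZ hA (CrealP (emb_real r)).
Qed.

Lemma hermsym_sum n (I : finType) (A : I -> 'M[C]_n) :
  (forall i, A i \is hermsymmx) -> \sum_i A i \is hermsymmx.
Proof.
move=> hA; elim/big_ind: _ => [|B B'|i _]; [|exact: hermsymD|exact: hA].
by apply/hermsymP; rewrite trmx0 map_mx0.
Qed.

Lemma hermsym_scalar n (r : R) : ((emb r)%:M : 'M[C]_n) \is hermsymmx.
Proof.
apply/hermsymP; rewrite tr_scalar_mx map_scalar_mx.
by congr (_%:M); exact: (CrealP (emb_real r)).
Qed.

Lemma mx_continuousM (T : topologicalType) m n p (f : T -> 'M[C]_(m, n))
    (g : T -> 'M[C]_(n, p)) :
  continuous f -> continuous g -> continuous (fun x => f x *m g x).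
Proof.
move=> /mx_continuousP cf /mx_continuousP cg; apply/mx_continuousP => i j.
rewrite (_ : (fun _ => _) = (fun x => \sum_k f x i k * g x k j)); last first.
  by apply/funext => x; rewrite mxE.
move=> x; apply: cvg_big => [|k _]; first exact: add_continuous.
exact: cvgM (cf i k x) (cg k j x).
Qed.

(** An entry is at most the Frobenius norm, and this norm is at most [n * e] when all entries are at
    most [e]; [pos_part_lip] links the two. *)
Lemma pos_part_entry n (A B P Q : 'M[C]_n) (e : C) : 0 <= e ->
  pos_part_of A P -> pos_part_of B Q -> (forall i j, `|A i j - B i j| <= e) ->
  forall i j, `|P i j - Q i j| <= n%:R * e.
Proof.
move=> e0 hP hQ hAB i j; rewrite -ler_sqr ?nnegrE ?mulr_ge0 //.
apply: le_trans (_ : sqnorm (P - Q) <= _).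
  rewrite /sqnorm (bigD1 i) //= (bigD1 j) //= !mxE -addrA lerDl addr_ge0 //.
    by rewrite sumr_ge0 // => k _; rewrite exprn_ge0.
  by rewrite sumr_ge0 // => k _; rewrite sumr_ge0 // => l _; rewrite exprn_ge0.
apply: le_trans (pos_part_lip hP hQ) _.
apply: le_trans (_ : \sum_(k < n) \sum_(l < n) e ^+ 2 <= _).
  apply: ler_sum => k _; apply: ler_sum => l _; rewrite !mxE.
  by rewrite ler_sqr ?nnegrE.
by rewrite !sumr_const !card_ord -mulrnA -(mulr_natl _ (n * n)) exprMn natrM.
Qed.

Lemma mx_near_continuous (T : topologicalType) m n (f : T -> 'M[C]_(m, n)) :
  (forall x (e : C), 0 < e -> \forall y \near x, forall i j, `|f x i j - f y i j| <= e) ->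
  continuous f.
Proof.
move=> h; apply/mx_continuousP => i j x; apply/cvgrPdist_le => /= e e0.
by apply: filterS (h x e e0) => y; apply.
Qed.

Lemma mx_continuous_near (T : topologicalType) m n (f : T -> 'M[C]_(m, n)) x (e : C) :
  continuous f -> 0 < e -> \forall y \near x, forall i j, `|f x i j - f y i j| <= e.
Proof.
move=> /mx_continuousP cf e0.
apply: filter_forall => i; apply: filter_forall => j.
by have /cvgrPdist_le := cf i j x; apply.
Qed.

Lemma pos_part_continuous (T : topologicalType) n (f P : T -> 'M[C]_n) :
  (forall x, pos_part_of (f x) (P x)) -> continuous f -> continuous P.
Proof.
move=> fP cf; apply: mx_near_continuous => x e e0.
(* The successor keeps the quotient meaningful for [n = 0]. *)
have e1 : 0 < e / n.+1%:R by rewrite divr_gt0.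
apply: filterS (mx_continuous_near x cf e1) => y hy i j.
apply: le_trans (pos_part_entry (ltW e1) (fP x) (fP y) hy i j) _.
by rewrite mulrCA ler_piMr ?(ltW e0) // ler_pdivrMr // mul1r ler_nat.
Qed.

Section Linked.
Variables (X : topologicalType) (m n : nat).
Local Notation Y := 'M[C]_(m, n).

(* [H] is continuous for all times, so that no subspace topology is needed. *)
Definition linked (S : set Y) (f g : X -> Y) := exists H : X * R -> Y,
  [/\ continuous H, forall x t, 0 <= t <= 1 -> S (H (x, t)),
      forall x, H (x, 0) = f x & forall x, H (x, 1) = g x].

Lemma slice_continuous (H : X * R -> Y) t : continuous H -> continuous (fun x => H (x, t)).
Proof.
move=> cH; apply: comp_continuous cH; apply: pair_continuous; first exact: id_continuous.
by move=> x; exact: cvg_cst.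
Qed.

Lemma linked_continuous (S : set Y) f g : linked S f g -> continuous f /\ continuous g.
Proof.
move=> [H [cH _ H0 H1]].
have [/funext <- /funext <-] : (forall x, H (x, 0) = f x) /\ (forall x, H (x, 1) = g x).
  by [].
by split; exact: slice_continuous.
Qed.

Lemma linked_sym (S : set Y) f g : linked S f g -> linked S g f.
Proof.
move=> [H [cH HS H0 H1]]; exists (fun z => H (z.1, 1 - z.2)); split.
- apply: comp_continuous cH; apply: pair_continuous; first exact: fst_continuous.
  by move=> z; apply: cvgB; [exact: cvg_cst|exact: cvg_snd].
- by move=> x t /andP[t0 t1] /=; apply: HS; rewrite subr_ge0 t1 lerBlDr lerDl.
- by move=> x /=; rewrite subr0.
- by move=> x /=; rewrite subrr.
Qed.

(** Retraction onto [[0, 1]]: a homotopy run at a clamped time rests at its ends, so that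
    concatenation requires no gluing along half-intervals. *)
Definition clamp (t : R) : R := Num.min (Num.max t 0) 1.

Lemma clamp_continuous : continuous clamp.
Proof.
move=> t; apply: (@continuous_min _ _ (fun t : R => Num.max t 0) (fun=> 1)).
  by apply: (@continuous_max _ _ id (fun=> 0)); [exact: cvg_id|exact: cvg_cst].
exact: cvg_cst.
Qed.

Lemma clamp01 t : 0 <= clamp t <= 1.
Proof. by rewrite /clamp le_min ge_min lexx orbT andbT le_max lexx orbT /=. Qed.

Lemma clamp_le0 t : t <= 0 -> clamp t = 0.
Proof. by move=> t0; rewrite /clamp max_r // min_l. Qed.

Lemma clamp_ge1 t : 1 <= t -> clamp t = 1.
Proof. by move=> t0; rewrite /clamp max_l ?min_r // (le_trans _ t0). Qed.

(* Since [H1 (x, 1) = g x = H2 (x, 0)], at each time two of the three terms of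
   the concatenated homotopy cancel. *)
Lemma linked_trans (S : set Y) f g h : linked S f g -> linked S g h -> linked S f h.
Proof.
move=> fg gh; have [_ cg] := linked_continuous fg.
case: fg gh => [H1 [c1 S1 H10 H11]] [H2 [c2 S2 H20 H21]].
exists (fun z => H1 (z.1, clamp (2 * z.2)) + H2 (z.1, clamp (2 * z.2 - 1)) - g z.1).
split.
- have caff (a : R) : continuous (fun z : X * R => clamp (2 * z.2 - a)).
    apply: comp_continuous clamp_continuous => z.
    by apply: cvgB; [apply: cvgM; [exact: cvg_cst|exact: cvg_snd]|exact: cvg_cst].
  have caff0 : continuous (fun z : X * R => clamp (2 * z.2)).
    by have := caff 0; under eq_fun do rewrite subr0.
  move=> z; apply: cvgB; first apply: cvgD.
  + by apply: comp_continuous c1 z; apply: pair_continuous => //; exact: fst_continuous.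
  + by apply: comp_continuous c2 z; apply: pair_continuous => //; exact: fst_continuous.
  + by apply: comp_continuous cg z; exact: fst_continuous.
- move=> x t t01 /=; have [t2|t2] := leP (2 * t) 1.
    by rewrite (@clamp_le0 (2 * t - 1)) ?subr_le0 // H20 addrK; apply/S1/clamp01.
  rewrite (@clamp_ge1 (2 * t)) ?(ltW t2) // H11 addrAC subrr add0r; apply/S2/clamp01.
- by move=> x /=; rewrite mulr0 sub0r !clamp_le0 // ?oppr_le0 // H20 addrK.
- move=> x /=; rewrite mulr1 !clamp_ge1 ?ler1n //; last by lra.
  by rewrite H11 addrAC subrr add0r.
Qed.

Lemma linked_homotopic (S : set Y) f g : linked S f g -> homotopic_in R S f g.
Proof.
move=> [H [cH HS H0 H1]]; exists H; split => //.
exact: continuous_subspaceT.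
Qed.

End Linked.

(** A tube argument: near each [x], the values at times close to [t] are close to those at [t], and
    compactness of [X] yields one neighbourhood of [t] valid for all [x]. *)
Lemma linked_path (X : topologicalType) n (S : set 'M[C]_n)
    (f g : {uniform X -> 'M[C]_n}) : compact [set: X] -> linked S f g ->
  exists c : R -> {uniform X -> 'M[C]_n},
  [/\ {within `[0, 1], continuous c},
      forall t, t \in `[0, 1] -> continuous_maps S (c t), c 0 = f & c 1 = g].
Proof.
move=> cX [H [cH HS H0 H1]]; exists (fun t x => H (x, t)); split.
- apply: continuous_subspaceT => t P /uniform_nbhs[E [entE EP]].
  have : \forall s \near t, [set: X] `<=` (fun x => E (H (x, t), H (x, s))).
    have /compact_near_coveringP cvX := cX.
    apply: (cvX R (nbhs t) (fun s x => E (H (x, t), H (x, s)))) => x _.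
    have [e /= e0 eE] : entourage_ (@ball C 'M[C]_n) E by rewrite entourage_ballE.
    (* Two errors of [e / 3] add up to strictly less than [e]. *)
    have e3 : 0 < e / 3%:R by rewrite divr_gt0.
    have [[A B] [/= nA nB] AB] := mx_continuous_near (x, t) cH e3.
    exists (A, B) => //= -[y s] [/= Ay Bs]; apply: eE; split=> // i j.
    rewrite /ball /= -[X in `|X|](subrKA (H (x, t) i j)).
    apply: le_lt_trans (ler_normD _ _) _; rewrite distrC.
    apply: le_lt_trans (lerD (AB (y, t) _ i j) (AB (y, s) _ i j)) _ => //=.
    - by split => //=; exact: nbhs_singleton.
    - rewrite -mulrDr gtr_pMr // -mulr2n -[_ *+ _]mulr_natl.
      by rewrite ltr_pdivrMr ?ltr0n // mul1r ltr_nat.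
  by apply: filterS => s hs; apply: EP => x _; apply: hs.
- move=> t; rewrite in_itv /= => t01; split; last by move=> x; apply: HS.
  exact: slice_continuous.
- by apply/funext => x; rewrite H0.
- by apply/funext => x; rewrite H1.
Qed.

End Homotopies.

(** * General position by counting grid points *)

Section GeneralPosition.
Local Open Scope sesquilinear_scope.
Variable R : realType.
Local Notation C := (Cplx R).

Lemma Cplx_archi (x : C) : x \is Num.real -> exists m : nat, x <= m%:R.
Proof.
move=> xr; have /= <- := RRe_real xr; exists (Num.bound `|complex.Re x|).
by rewrite -emb_nat lecR (le_trans (ler_norm _)) // ltW // archi_boundP.
Qed.

Lemma ler_norm_rect (a b r : C) : a \is Num.real -> b \is Num.real ->
  `|a + 'i * b| <= r -> `|a| <= r /\ `|b| <= r.
Proof.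
move=> ar br h; have r0 : 0 <= r := le_trans (normr_ge0 _) h.
move: h; rewrite -ler_sqr ?nnegrE // normC2_rect // => h.
have a2 := real_exprn_even_ge0 ar (isT : ~~ odd 2).
have b2 := real_exprn_even_ge0 br (isT : ~~ odd 2).
split; rewrite -ler_sqr ?nnegrE //; rewrite real_normK //.
  by apply: le_trans h; rewrite lerDl.
by apply: le_trans h; rewrite lerDr.
Qed.

Section GridPoints.
Variables (n N : nat).
Hypothesis N0 : (0 < N)%N.
Local Notation pt := ('I_N * 'I_N)%type.
Local Notation grid := {ffun 'I_n -> pt}.

Definition gridC (p : pt) : C := (p.1%:R + 'i * p.2%:R) / N%:R.

Lemma gridC_norm p : `|gridC p| <= 2.
Proof.
rewrite normrM normfV normr_nat ler_pdivrMr ?ltr0n //.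
apply: le_trans (ler_normD _ _) _; rewrite normrM normCi mul1r !normr_nat.
by rewrite -natrD -natrM ler_nat; have := ltn_ord p.1; have := ltn_ord p.2; lia.
Qed.

Variables (K del : C) (Mb : nat).
Hypotheses (K0 : 0 <= K) (del0 : 0 < del) (KMb : 2 * K / del < Mb%:R).

(** The discrete form of a vanishing product: it holds, for suitable [K], once [s] is within
    [O(N^-1)] of a row annihilated by the column. *)
Definition small (s : 'rV[C]_n) (c : grid) : bool :=
  `|\sum_i s 0 i * gridC (c i)| <= K / N%:R.

(* Two small columns that differ only in row [i] are less than [Mb] grid steps
   apart there, so residues modulo [Mb] distinguish them. *)
Lemma small_card (s : 'rV[C]_n) (i : 'I_n) : del <= `|s 0 i| ->
  (#|[pred c | small s c]| * N ^ 2 <= #|{: grid}| * Mb ^ 2)%N.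
Proof.
move=> si; have Mb0 : (0 < Mb)%N.
  rewrite -(ltr0n C) (le_lt_trans _ KMb) // divr_ge0 ?mulr_ge0 ?(ltW del0) //.
(* The entry in row [i] is overwritten by a free point, which accounts for the factor [N ^ 2]; of
   the old entry [g] retains only the residues. *)
pose f (x : grid * pt) : grid * (pt * ('I_Mb * 'I_Mb)) :=
  ([ffun j => if j == i then x.2 else x.1 j],
   (x.2, (Ordinal (ltn_pmod (x.1 i).1 Mb0), Ordinal (ltn_pmod (x.1 i).2 Mb0)))).
pose g x := ((f x).1, (f x).2.2).
have ginj : {in [predX [pred c | small s c] & {: pt}] &, injective g}.
  move=> [c v] [c' v']; rewrite !inE !andbT /= => hc hc' [].
  move=> /ffunP e ea eb.
  have ev : v = v' by have := e i; rewrite !ffunE eqxx.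
  have ec j : j != i -> c j = c' j.
    by move=> ji; have := e j; rewrite !ffunE (negbTE ji).
  suff eci : c i = c' i.
    congr (_, _) => //; apply/ffunP => j.
    by have [->|/ec] := eqVneq j i.
  have : `|s 0 i * (gridC (c i) - gridC (c' i))| <= 2 * K / N%:R.
    have -> : s 0 i * (gridC (c i) - gridC (c' i)) =
        \sum_i s 0 i * gridC (c i) - \sum_i s 0 i * gridC (c' i).
      rewrite -sumrB (bigD1 i) //= big1 ?addr0 ?mulrBr // => j /ec ->.
      by rewrite subrr.
    apply: le_trans (ler_normB _ _) _; apply: le_trans (lerD hc hc') _.
    by rewrite mulrDl mul1r mulrDl.
  rewrite normrM /gridC -mulrBl normrM normfV normr_nat mulrA.
  rewrite ler_pM2r ?invr_gt0 ?ltr0n // => h.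
  have {}h : del * `|(c i).1%:R + 'i * (c i).2%:R - ((c' i).1%:R + 'i * (c' i).2%:R)| <= 2 * K.
    by apply: le_trans h; rewrite ler_wpM2r.
  move: h; rewrite mulrC -ler_pdivlMr // => h.
  have {h} [h1 h2] : `|(c i).1%:R - (c' i).1%:R : C| <= 2 * K / del
      /\ `|(c i).2%:R - (c' i).2%:R : C| <= 2 * K / del.
    apply: ler_norm_rect; rewrite ?rpredB ?realn //.
    by move: h; rewrite opprD addrACA mulrBr.
  have key (a b : 'I_N) : a = b %[mod Mb] -> `|a%:R - b%:R : C| <= 2 * K / del -> a = b.
    move=> ab /le_lt_trans /(_ KMb).
    wlog lab : a b ab / (a <= b)%N => [hw|].
      case/orP: (leq_total a b) => [|ba] h'; first exact: hw.
      by apply/esym/hw => //; rewrite distrC.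
    rewrite distrC -natrB // normr_nat ltr_nat => h'.
    apply: val_inj => /=.
    have : (Mb %| b - a)%N by rewrite -eqn_mod_dvd // ab.
    case: (posnP (b - a)%N) => [/eqP|p0]; last by rewrite gtnNdvd.
    by rewrite subn_eq0 => ba _; apply/eqP; rewrite eqn_leq lab.
  by rewrite [c i]surjective_pairing [c' i]surjective_pairing (key _ _ ea h1) (key _ _ eb h2).
have <- : #|[predX [pred c | small s c] & {: pt}]| = (#|[pred c | small s c]| * N ^ 2)%N.
  by rewrite cardX card_prod !card_ord.
rewrite -(card_in_image ginj) (leq_trans (max_card _)) //.
by rewrite !card_prod !card_ord.
Qed.

(* The number of indices that stay bad is averaged over all grid columns. *)
Lemma column_reduce (J : finType) (s : J -> 'rV[C]_n) (A : pred J) :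
  (forall j, A j -> exists i, del <= `|s j 0 i|) ->
  exists c : grid, (#|[pred j | A j && small (s j) c]| * N ^ 2 <= #|A| * Mb ^ 2)%N.
Proof.
move=> hA; apply/existsP; apply: contraT; rewrite negb_exists => /forallP h.
have g0 : (0 < #|{: grid}|)%N.
  by apply/card_gt0P; exists [ffun=> (Ordinal N0, Ordinal N0)].
have : (\sum_(c : grid) (#|A| * Mb ^ 2).+1 <=
    \sum_(c : grid) #|[pred j | A j && small (s j) c]| * N ^ 2)%N.
  by apply: leq_sum => c _; rewrite ltnNge h.
rewrite sum_nat_const -big_distrl /=.
have -> : (\sum_(c : grid) #|[pred j | A j && small (s j) c]| =
    \sum_(j | A j) #|[pred c | small (s j) c]|)%N.
  transitivity (\sum_(c : grid) \sum_(j | A j) (if small (s j) c then 1 else 0))%N.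
    by apply: eq_bigr => c _; rewrite -sum1_card -big_mkcondr; apply: eq_bigl => j.
  rewrite exchange_big /=; apply: eq_bigr => j _.
  by rewrite -sum1_card -big_mkcond; apply: eq_bigl => c.
rewrite leqNgt => /negP[]; rewrite mulnS -[ltnLHS]add0n -addSn leq_add //.
rewrite big_distrl /= mulnCA -sum_nat_const; apply: leq_sum => j /hA[i si].
exact: small_card si.
Qed.

(** Columns are chosen one after another, each for the indices still bad, and each choice gains the
    factor [Mb ^ 2 / N ^ 2]. *)
Lemma columns_reduce (J : finType) (s : J -> 'rV[C]_n) (A : pred J) k :
  (forall j, A j -> exists i, del <= `|s j 0 i|) ->
  exists c : 'I_k -> grid,
    (#|[pred j | A j && [forall t, small (s j) (c t)]]| * (N ^ 2) ^ k <=
     #|A| * (Mb ^ 2) ^ k)%N.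
Proof.
elim: k A => [|k IH] A hA.
  exists (fun=> [ffun=> (Ordinal N0, Ordinal N0)]); rewrite !expn0 !muln1.
  by apply: subset_leq_card; apply/fintype.subsetP => j; rewrite !inE => /andP[].
have [c hc] := column_reduce hA.
have [j|c' hc'] := IH [pred j | A j && small (s j) c].
  by case/andP => /hA.
exists (fun t => if unlift ord0 t is Some t' then c' t' else c).
rewrite (expnS (N ^ 2)) (expnS (Mb ^ 2)).
set u := #|_| in hc'; set w := #|[pred j | _ && _]|.
have -> : w = u.
  apply: eq_card => j; rewrite !inE -andbA; congr (_ && _).
  apply/forallP/andP => [h|[h /forallP h'] t].
    split; first by have := h ord0; rewrite unlift_none.
    by apply/forallP => t; have := h (lift ord0 t); rewrite liftK.
  by case: unliftP.
rewrite mulnCA; apply: leq_trans (leq_mul (leqnn _) hc') _.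
by rewrite mulnA [leqRHS]mulnA leq_mul2r mulnC hc orbT.
Qed.

End GridPoints.

Lemma unit_grid (N : nat) (x : R) : (0 < N)%N -> 0 <= x <= 1 ->
  exists a : 'I_N, `|x - a%:R / N%:R| <= N%:R^-1.
Proof.
move=> N0 /andP[x0 x1]; have NR : 0 < N%:R :> R by rewrite ltr0n.
have Nx0 : 0 <= x * N%:R by rewrite mulr_ge0 // ltW.
have /andP[] := truncn_itv Nx0; set t := Num.truncn _ => t1 t2.
have xE : x = x * N%:R / N%:R by rewrite mulfK ?gt_eqF.
have [tN|Nt] := ltnP t N.
  exists (Ordinal tN) => /=; rewrite {1}xE -mulrBl normrM normfV.
  rewrite (ger0_norm (ltW NR)) ger0_norm ?subr_ge0 //.
  rewrite ler_piMl ?invr_ge0 ?(ltW NR) // lerBlDl.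
  by rewrite natr1 ltW.
(* Only [x = 1] truncates to [N], which is out of range; the last grid point is then at distance
   exactly [N^-1]. *)
have N1 : (N.-1 < N)%N by rewrite prednK.
exists (Ordinal N1) => /=.
have NN : N.-1%:R = N%:R - 1 :> R by rewrite -[in RHS](prednK N0) -natr1 addrK.
have xN : N%:R <= x * N%:R by apply: le_trans t1; rewrite ler_nat.
have -> : x = 1 by apply/eqP; rewrite eq_le x1 /= -(ler_pM2r NR) mul1r.
rewrite NN mulrBl divff ?gt_eqF // mul1r subKr ger0_norm // invr_ge0 ltW //.
Qed.

Definition unit_box (D : nat) (th : nat -> R) : Prop :=
  forall r, (r < D)%N -> 0 <= th r <= 1.

(* The values of [G] form a set of real dimension at most [D < 2k], so that a
   linear map to [C^k] avoiding [0] on them exists; the fractions of bad grid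
   columns are estimated on an [N^-1]-net of cardinality [O(N^D)]. *)
Lemma generic_columns (T : finType) (n k D : nat)
    (G : T -> (nat -> R) -> 'rV[C]_n) (L del : C) :
  (D < 2 * k)%N -> 0 < del -> 0 <= L ->
  (forall t th th' (e : R), unit_box D th -> unit_box D th' -> 0 <= e ->
    (forall r, (r < D)%N -> `|th r - th' r| <= e) ->
    forall j, `|G t th 0 j - G t th' 0 j| <= L * emb e) ->
  exists M : 'M[C]_(n, k), forall t th, unit_box D th ->
    (exists j, del <= `|G t th 0 j|) -> G t th *m M != 0.
Proof.
move=> Dk del0 L0 GL.
pose K : C := n%:R * (L * 2).
have K0 : 0 <= K by rewrite !mulr_ge0.
have del2 : 0 < del / 2 by rewrite divr_gt0.
have [m hm] := @Cplx_archi (2 * K / (del / 2)) (ger0_real (divr_ge0 (mulr_ge0 (ler0n _ _) K0) (ltW del2))).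
pose Mb := m.+1; have KMb : 2 * K / (del / 2) < Mb%:R.
  by apply: le_lt_trans hm _; rewrite ltr_nat.
have [m' hm'] := @Cplx_archi (2 * L / del) (ger0_real (divr_ge0 (mulr_ge0 (ler0n _ _) L0) (ltW del0))).
(* The term [m'] makes the discretization error at most [del / 2], the product makes the number of
   bad indices less than one, and [.+2] gives [N > 1] for comparing powers. *)
pose N := (m' + #|T| * (Mb ^ 2) ^ k).+2.
have N0 : (0 < N)%N by [].
have NL : L / N%:R <= del / 2.
  have : 2 * L / del <= N%:R.
    by apply: le_trans hm' _; rewrite ler_nat /N -!addnS leq_addr.
  rewrite !ler_pdivrMr ?ltr0n // => h.
  rewrite -(ler_pM2l (ltr0Sn _ 1)); apply: le_trans h _.
  by rewrite le_eqVlt; apply/orP; left; apply/eqP; field.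
pose th_of (a : {ffun 'I_D -> 'I_N}) (r : nat) : R :=
  if insub r is Some r' then (a r')%:R / N%:R else 0.
pose s (j : T * {ffun 'I_D -> 'I_N}) := G j.1 (th_of j.2).
pose A := [pred j | [exists i, del / 2 <= `|s j 0 i|]].
have hA j : A j -> exists i, del / 2 <= `|s j 0 i| by move/existsP.
have [c hc] := columns_reduce N0 K0 del2 KMb k hA.
have th_box a : unit_box D (th_of a).
  move=> r rD; rewrite /th_of insubT; apply/andP; split.
    by rewrite divr_ge0.
  by rewrite ler_pdivrMr ?ltr0n // mul1r ler_nat ltnW.
(* The number of bad indices times [N ^ (2 * k)] is at most [#|T| * N ^ D * Mb ^ (2 * k)], which is
   less than [N ^ D.+1], hence than [N ^ (2 * k)] because [D < 2 * k]. *)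
have none : forall j, A j -> ~~ [forall t, small K (s j) (c t)].
  move=> j Aj; apply/negP => hj; move: hc; rewrite leqNgt => /negP[].
  apply: (@leq_ltn_trans (#|T| * N ^ D * (Mb ^ 2) ^ k)%N).
    by rewrite leq_mul2r (leq_trans (max_card _)) ?orbT // card_prod card_ffun !card_ord.
  apply: (@leq_trans (N * N ^ D)%N).
    by rewrite mulnAC ltn_mul2r expn_gt0 /= /N ltnS leqW ?leq_addl.
  apply: (@leq_trans ((N ^ 2) ^ k)%N).
    by rewrite -expnS -expnM leq_exp2l // ?ltnS.
  by rewrite leq_pmull //; apply/card_gt0P; exists j; rewrite inE Aj.
exists (\matrix_(i, t) gridC (c t i)) => t th hth [j0 hj0]; apply/negP => /eqP hM.
have [a ha] : exists a : {ffun 'I_D -> 'I_N}, forall r, (r < D)%N ->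
    `|th r - th_of a r| <= N%:R^-1.
  have /fin_all_exists[a ha] : forall r : 'I_D, exists b : 'I_N, `|th r - b%:R / N%:R| <= N%:R^-1.
    by move=> r; apply: unit_grid => //; apply: hth.
  exists (finfun a) => r rD; rewrite /th_of insubT ffunE.
  exact: (ha (Ordinal rD)).
have Ni0 : 0 <= N%:R^-1 :> R by rewrite invr_ge0.
have close i : `|G t th 0 i - s (t, a) 0 i| <= L / N%:R.
  apply: le_trans (GL t th (th_of a) _ hth (th_box a) Ni0 ha i) _.
  by rewrite /emb fmorphV rmorph_nat.
(* Passing to the nearby net point costs at most half of the lower bound [del]. *)
have Aj : A (t, a).
  apply/existsP; exists j0; rewrite -(lerD2r (del / 2)) -splitr.
  apply: (le_trans hj0); rewrite -[X in `|X| <= _](subrK (s (t, a) 0 j0)) addrC.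
  by apply: le_trans (ler_normD _ _) _; rewrite lerD2l (le_trans (close _)).
have /negP[] := none _ Aj; apply/forallP => q; rewrite /small.
(* The exact row is annihilated by column [q], so only its distance to the net row contributes. *)
have -> : \sum_i s (t, a) 0 i * gridC (c q i) =
   \sum_i (s (t, a) 0 i - G t th 0 i) * gridC (c q i).
  have h0 : \sum_i G t th 0 i * gridC (c q i) = 0.
    have /rowP/(_ q) := hM; rewrite !mxE => h0; rewrite -[RHS]h0.
    by apply: eq_bigr => i _; rewrite mxE.
  under [RHS]eq_bigr do rewrite mulrBl.
  by rewrite sumrB h0 subr0.
apply: le_trans (ler_norm_sum _ _ _) _.
apply: le_trans (_ : \sum_(i < n) L / N%:R * 2 <= _).
  apply: ler_sum => i _; rewrite normrM ler_pM // ?gridC_norm //.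
  by rewrite distrC.
rewrite sumr_const card_ord -[leLHS]mulr_natl /K -!mulrA.
by rewrite [N%:R^-1 * _]mulrC.
Qed.

End GeneralPosition.

(** * Lipschitz families over the unit box and thin sets of row vectors *)

Section LipschitzFamilies.
Local Open Scope sesquilinear_scope.
Variable R : realType.
Local Notation C := (Cplx R).
Variable D : nat.

(** Boundedness is included to make the class closed under products. On the box only the first [D]
    coordinates of a parameter matter. *)
Definition lipb (h : (nat -> R) -> C) : Prop := exists L : C,
  [/\ 0 <= L, forall th, unit_box D th -> `|h th| <= L &
      forall th th' (e : R), unit_box D th -> unit_box D th' -> 0 <= e ->
        (forall r, (r < D)%N -> `|th r - th' r| <= e) ->
        `|h th - h th'| <= L * emb e].

Lemma lipb_cst c : lipb (fun=> c).
Proof.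
exists `|c|; split=> // th th' e _ _ e0 _.
by rewrite subrr normr0 mulr_ge0 // emb_ge0.
Qed.

Lemma lipbD h1 h2 : lipb h1 -> lipb h2 -> lipb (fun th => h1 th + h2 th).
Proof.
move=> [L1 [L10 b1 l1]] [L2 [L20 b2 l2]]; exists (L1 + L2); split.
- by rewrite addr_ge0.
- by move=> th ht; apply: le_trans (ler_normD _ _) _; apply: lerD; [apply: b1|apply: b2].
- move=> th th' e ht ht' e0 he; rewrite opprD addrACA mulrDl.
  by apply: le_trans (ler_normD _ _) _; apply: lerD; [apply: l1|apply: l2].
Qed.

Lemma lipbM h1 h2 : lipb h1 -> lipb h2 -> lipb (fun th => h1 th * h2 th).
Proof.
move=> [L1 [L10 b1 l1]] [L2 [L20 b2 l2]]; exists (L1 * L2 + L1 * L2); split.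
- by rewrite addr_ge0 ?mulr_ge0.
- move=> th ht; rewrite normrM; apply: (@le_trans _ _ (L1 * L2)).
    by rewrite ler_pM ?b1 ?b2.
  by rewrite lerDl mulr_ge0.
- move=> th th' e ht ht' e0 he.
  have -> : h1 th * h2 th - h1 th' * h2 th' =
     h1 th * (h2 th - h2 th') + (h1 th - h1 th') * h2 th'.
    by rewrite mulrBr mulrBl addrA subrK.
  rewrite [leRHS]mulrDl; apply: le_trans (ler_normD _ _) _; apply: lerD; rewrite normrM.
    by rewrite -mulrA ler_pM ?b1 ?l2.
  by rewrite mulrAC ler_pM ?b2 ?l1.
Qed.

Lemma lipb_sum (I : Type) (s : seq I) (h : I -> (nat -> R) -> C) :
  (forall i, lipb (h i)) -> lipb (fun th => \sum_(i <- s) h i th).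
Proof.
move=> hl; elim: s => [|i s IH].
  by under eq_fun do rewrite big_nil; exact: lipb_cst.
by under eq_fun do rewrite big_cons; apply: lipbD.
Qed.

Lemma lipb_coord r : (r < D)%N -> lipb (fun th => emb (th r)).
Proof.
move=> rD; have nE (x : R) : `|emb x| = emb `|x|.
  by rewrite /emb normc_def /= expr0n addr0 sqrtr_sqr.
exists 1; split=> // [th /(_ r rD)/andP[t0 t1]|th th' e _ _ _ he].
  by rewrite nE ger0_norm // lecR.
by rewrite mul1r -rmorphB nE lecR he.
Qed.

Definition lipmx m n (A : (nat -> R) -> 'M[C]_(m, n)) :=
  forall i j, lipb (fun th => A th i j).

Lemma lipmx_cst m n (A : 'M[C]_(m, n)) : lipmx (fun=> A).
Proof. by move=> i j; apply: lipb_cst. Qed.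

Lemma lipmxM m n p (A : (nat -> R) -> 'M[C]_(m, n)) (B : (nat -> R) -> 'M[C]_(n, p)) :
  lipmx A -> lipmx B -> lipmx (fun th => A th *m B th).
Proof.
move=> hA hB i j; under eq_fun do rewrite mxE.
by apply: lipb_sum => k; apply: lipbM.
Qed.

(** Both estimates come from [pos_part_entry]: comparing two parameters gives the Lipschitz bound,
    comparing with the positive part of [0] gives boundedness. *)
Lemma lipmx_pos n (A P : (nat -> R) -> 'M[C]_n) :
  (forall th, pos_part_of (A th) (P th)) -> lipmx A -> lipmx P.
Proof.
move=> AP hA; have {}hA : forall ij : 'I_n * 'I_n, lipb (fun th => A th ij.1 ij.2).
  by move=> [i j]; apply: hA.
have [L hL] := fin_all_exists hA.
have L0 ij : 0 <= L ij by case: (hL ij).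
pose M := \sum_ij L ij.
have LM i j : L (i, j) <= M.
  by rewrite /M (bigD1 (i, j)) //= lerDl sumr_ge0.
have M0 : 0 <= M by rewrite sumr_ge0.
have pos0 : pos_part_of (0 : 'M[C]_n) 0.
  by apply: pos_part_id; have := gram_nonneg (0 : 'M[C]_n); rewrite mul0mx.
move=> i j; exists (n%:R * M); split; first by rewrite mulr_ge0.
- move=> th ht; have := pos_part_entry M0 (AP th) pos0 _ i j.
  rewrite !mxE subr0; apply=> a b; rewrite mxE subr0.
  by have [_ h _] := hL (a, b); apply: le_trans (h th ht) _.
- move=> th th' e ht ht' e0 he; rewrite -mulrA.
  apply: pos_part_entry (AP th) (AP th') _ i j => [|a b].
    by rewrite mulr_ge0 // emb_ge0.
  have [_ _ h] := hL (a, b); apply: le_trans (h th th' e ht ht' e0 he) _.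
  by rewrite ler_wpM2r ?emb_ge0.
Qed.

(** Sets of dimension at most [D] in the Lipschitz sense. The uniform bound [del] survives
    discretization, as mere nonvanishing would not. *)
Definition thin n (V : set 'rV[C]_n) : Prop :=
  exists (T : finType) (G : T -> (nat -> R) -> 'rV[C]_n) (del : C),
  [/\ 0 < del, forall t, lipmx (G t) &
     forall v, V v -> (exists j, del <= `|v 0 j|) /\
       exists t th, unit_box D th /\ v = G t th].

(** Unions are what allow a single [M] to serve two maps. *)
Lemma thinU n (V W : set 'rV[C]_n) : thin V -> thin W -> thin (V `|` W).
Proof.
move=> [T [G [d [d0 hG hV]]]] [T' [G' [d' [d0' hG' hW]]]].
have [m [m0 md md']] : exists m : C, [/\ 0 < m, m <= d & m <= d'].
  have [h|/ltW h] := real_leP (gtr0_real d0) (gtr0_real d0').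
    by exists d; split.
  by exists d'; split.
exists (T + T')%type, (fun t => match t with inl t => G t | inr t => G' t end), m.
split=> // [[]//|v [/hV|/hW] [[j hj] [t [th [bt e]]]]]; split.
- by exists j; apply: le_trans hj.
- by exists (inl t), th.
- by exists j; apply: le_trans hj.
- by exists (inr t), th.
Qed.

Lemma thin_avoid n k (V : set 'rV[C]_n) : (D < 2 * k)%N -> thin V ->
  exists M : 'M[C]_(n, k), forall v, V v -> v *m M != 0.
Proof.
move=> Dk [T [G [d [d0 hG hV]]]].
have {}hG : forall tj : T * 'I_n, lipb (fun th => G tj.1 th 0 tj.2).
  by move=> [t j]; apply: hG.
have [L hL] := fin_all_exists hG.
have L0 ij : 0 <= L ij by case: (hL ij).
have [|t th th' e ht ht' e0 he j|M hM] :=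
    @generic_columns R T n k D G (\sum_tj L tj) d Dk d0.
- by rewrite sumr_ge0.
- have [_ _ h] := hL (t, j); apply: le_trans (h th th' e ht ht' e0 he) _.
  by rewrite ler_wpM2r ?emb_ge0 // (bigD1 (t, j)) //= lerDl sumr_ge0.
- by exists M => v /hV[hj [t [th [bt e]]]]; rewrite e in hj *; apply: hM.
Qed.

End LipschitzFamilies.

(** * Quantitative rank bounds *)

Section RankBounds.
Local Open Scope sesquilinear_scope.
Variable R : realType.
Local Notation C := (Cplx R).

(** [A] and [B] undo the base changes of the rank factorization and truncate to [l] coordinates.
    Such a pair certifies the rank bound in a way that is stable under perturbation of [y]. *)
Lemma rank_factor1 (F : fieldType) n l (y : 'M[F]_n) : (l <= \rank y)%N ->
  exists (A : 'M[F]_(l, n)) (B : 'M[F]_(n, l)), A *m y *m B = 1%:M.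
Proof.
move=> ly; have ln := leq_trans ly (rank_leq_row y).
exists (pid_mx l *m invmx (col_ebase y)), (invmx (row_ebase y) *m pid_mx l).
rewrite -{2}(mulmx_ebase y) !mulmxA mulmxKV ?col_ebase_unit //.
rewrite mulmxK ?row_ebase_unit // !mul_pid_mx.
rewrite (_ : minn _ _ = l) ?pid_mx_1 //.
by lia.
Qed.

(** Dividing by a coordinate of largest modulus brings every nonzero row to this form, which leaves
    [2 (l - 1)] bounded real parameters. *)
Definition normalized_at l (u : 'rV[C]_l) (i : 'I_l) : Prop :=
  u 0 i = 1 /\ forall j, `|u 0 j| <= 1.

Lemma normalize l (u : 'rV[C]_l) : u != 0 -> exists (c : C) i, normalized_at (c *: u) i.
Proof.
move=> u0; have [i0 ui0] : exists i0, u 0 i0 != 0.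
  apply/existsP; apply: contraNT u0; rewrite negb_exists => /forallP h.
  by apply/eqP/rowP => i; rewrite mxE; apply/eqP; rewrite -[_ == _]negbK h.
(* The maximum is taken in [R], since the order of [C] is not total. *)
pose F i : R := complex.Re `|u 0 i|.
have FE i : emb (F i) = `|u 0 i| by exact: RRe_real (normr_real _).
case: (@arg_maxP _ _ _ i0 predT F isT) => i _ hi.
have ui j : `|u 0 j| <= `|u 0 i| by rewrite -!FE lecR; apply: hi.
have ui1 : u 0 i != 0 by rewrite -normr_gt0 (lt_le_trans _ (ui i0)) // normr_gt0.
exists (u 0 i)^-1, i; split=> [|j]; first by rewrite mxE mulVf.
by rewrite mxE normrM normfV mulrC ler_pdivrMr ?normr_gt0 // mul1r.
Qed.

Lemma rank_ge_normalized l p (Z : 'M[C]_(l, p)) :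
  (forall u i, normalized_at u i -> u *m Z != 0) -> (l <= \rank Z)%N.
Proof.
move=> h; rewrite -{1}(mxrank1 C l); apply: rank_le_ker => u uZ.
rewrite mulmx1; apply/eqP; apply: contraT => /normalize[c [i hi]].
by have := h _ _ hi; rewrite -scalemxAl uZ scaler0 eqxx.
Qed.

Definition near1 l (Z : 'M[C]_l) : Prop :=
  forall i j, `|Z i j - (i == j)%:R| <= (2 * l%:R)^-1.

(** The entry is [1] plus [l] errors, each of modulus at most [(2 * l)^-1]. *)
Lemma near1_row l (Z : 'M[C]_l) u i : near1 Z -> normalized_at u i ->
  2^-1 <= `|(u *m Z) 0 i|.
Proof.
move=> hZ [ui hu]; have l0 : (0 < l)%N by apply: leq_ltn_trans (ltn_ord i).
have e : (u *m Z) 0 i = 1 + \sum_j u 0 j * (Z j i - (j == i)%:R).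
  have hi : \sum_j u 0 j * (j == i)%:R = 1.
    by rewrite (bigD1 i) //= eqxx mulr1 big1 ?addr0 // => j /negbTE ->; rewrite mulr0.
  rewrite mxE; under [in RHS]eq_bigr do rewrite mulrBr.
  by rewrite sumrB hi addrC subrK.
have hs : `|\sum_j u 0 j * (Z j i - (j == i)%:R)| <= 2^-1.
  apply: le_trans (ler_norm_sum _ _ _) _.
  apply: (@le_trans _ _ (\sum_(j < l) (2 * l%:R)^-1)).
    by apply: ler_sum => j _; rewrite normrM -[leRHS]mul1r ler_pM.
  rewrite sumr_const card_ord -[leLHS]mulr_natl invfM mulrCA divff ?mulr1 //.
  by rewrite pnatr_eq0 -lt0n.
rewrite e -(lerD2r 2^-1).
apply: (@le_trans _ _ 1); first by rewrite le_eqVlt; apply/orP; left; apply/eqP; field.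
set s := \sum_j _ in hs *; rewrite -[leLHS]normr1 -[X in `|X| <= _](addrK s).
by apply: le_trans (ler_normB _ _) _; rewrite lerD2l.
Qed.

Lemma entry_bound m n (A : 'M[C]_(m, n)) : exists a : C, 0 < a /\ forall i j, `|A i j| <= a.
Proof.
exists (1 + \sum_ij `|A ij.1 ij.2|); split=> [|i j]; first by rewrite ltr_pwDl ?sumr_ge0.
by rewrite (bigD1 (i, j)) //= addrCA lerDl addr_ge0 // sumr_ge0.
Qed.

Lemma near1_open n l (y0 : 'M[C]_n) (A : 'M[C]_(l, n)) (B : 'M[C]_(n, l)) :
  A *m y0 *m B = 1%:M -> exists e : C, 0 < e /\
  forall y : 'M[C]_n, (forall i j, `|y0 i j - y i j| <= e) -> near1 (A *m y *m B).
Proof.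
move=> h; have [a [a0 ha]] := entry_bound A; have [b [b0 hb]] := entry_bound B.
(* Successors keep [c] positive when [n] or [l] is [0]. *)
pose c : C := n.+1%:R * b * (n.+1%:R * a) * (2 * l.+1%:R).
have c0 : 0 < c by rewrite !mulr_gt0.
exists c^-1; split=> [|y hy i j]; first by rewrite invr_gt0.
have -> : (A *m y *m B) i j - (i == j)%:R = - (A *m (y0 - y) *m B) i j.
  by rewrite mulmxBr mulmxBl h !mxE; ring.
rewrite normrN mxE; apply: le_trans (ler_norm_sum _ _ _) _.
apply: (@le_trans _ _ (\sum_(k < n) (n%:R * (a * c^-1)) * b)).
  apply: ler_sum => k _; rewrite normrM ler_pM // mxE.
  apply: le_trans (ler_norm_sum _ _ _) _.
  apply: (@le_trans _ _ (\sum_(k < n) a * c^-1)).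
    by apply: ler_sum => q _; rewrite normrM ler_pM // !mxE hy.
  by rewrite sumr_const card_ord -[leLHS]mulr_natl.
rewrite sumr_const card_ord -[leLHS]mulr_natl.
have l0 : (0 < l)%N by apply: leq_ltn_trans (ltn_ord i).
rewrite -[leRHS]mul1r ler_pdivlMr ?mulr_gt0 ?ltr0n //.
have -> : n%:R * (n%:R * (a / c) * b) * (2 * l%:R) = (n%:R * b * (n%:R * a) * (2 * l%:R)) / c.
  by ring.
rewrite ler_pdivrMr // mul1r /c.
have nn : n%:R <= n.+1%:R :> C by rewrite ler_nat.
have ll : l%:R <= l.+1%:R :> C by rewrite ler_nat.
by rewrite !ler_pM ?mulr_ge0 ?(ltW a0) ?(ltW b0).
Qed.

End RankBounds.

(** * Partitions of unity *)

Section PartitionOfUnity.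
Variable X : topologicalType.
Hypothesis compactX : compact [set: X].

(** The near-covering form of compactness, applied to the filter generated by the sets of lists
    containing a given finite list. *)
Lemma finite_cover (V : X -> set X) : (forall x, nbhs x (V x)) ->
  exists s : seq X, forall y, exists2 x, x \in s & V x y.
Proof.
move=> hV; pose F : set_system (seq X) :=
  [set Q | exists s0 : seq X, forall s : seq X, {subset s0 <= s} -> Q s].
have FF : Filter F.
  split=> [|P Q [s1 h1] [s2 h2]|P Q PQ [s hs]].
  - by exists [::].
  - exists (s1 ++ s2) => s hs; split.
      by apply: h1 => x xs; apply: hs; rewrite mem_cat xs.
    by apply: h2 => x xs; apply: hs; rewrite mem_cat xs orbT.
  - by exists s => s' /hs; apply: PQ.
have /compact_near_coveringP cX := compactX.
have : \forall s \near F, [set: X] `<=` (fun y => exists2 x, x \in s & V x y).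
  apply: (cX (seq X) F (fun s y => exists2 x, x \in s & V x y)) => x _.
  exists (V x, [set s : seq X | x \in s]) => /=.
    by split=> //; exists [:: x] => s; apply; rewrite mem_head.
  by move=> [y s] [/= Vy xs]; exists x.
by move=> [s hs]; exists s => y; apply: hs.
Qed.

Hypothesis hausdorffX : hausdorff_space X.
Variable R : realType.

(** A Urysohn function for the complement of [V] and the point [x]; a compact Hausdorff space is
    normal. *)
Lemma bump (V : set X) (x : X) : open V -> V x ->
  exists u : X -> R, [/\ continuous u, forall y, 0 <= u y, u x = 1 &
    forall y, u y != 0 -> V y].
Proof.
move=> oV Vx.
have sep : uniform_separator (~` V) [set x].
  apply: (proj1 (@normal_separatorP R X)).
  - exact: compact_normal.
  - exact: open_closedC.
  - by apply: accessible_closed_set1; apply: hausdorff_accessible.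
  - by rewrite -subset0 => y [+ /= yx]; rewrite yx.
exists (Urysohn (~` V) [set x]); split.
- exact: Urysohn_continuous.
- move=> y; have /(_ (Urysohn (~` V) [set x] y)) := @Urysohn_range X R (~` V) [set x].
  by rewrite /= in_itv /= => h; have /andP[] := h (ex_intro2 _ _ y I erefl).
- by apply: (Urysohn_sub1 sep); exists x.
- move=> y; apply: contraPP => nVy; apply/negP; rewrite negbK; apply/eqP.
  by apply: (Urysohn_sub0 sep); exists y.
Qed.

(** Each point has a bump vanishing outside some [V j]. Finitely many sets where a bump exceeds
    [1/2] cover [X]; bumps with the same [j] are added and the sums divided by their positive
    total. *)
Lemma partition_of_unity q (V : 'I_q -> set X) : (forall j, open (V j)) ->
  \bigcup_j V j = [set: X] ->
  exists phi : 'I_q -> X -> R, [/\ forall j, continuous (phi j),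
    forall j x, 0 <= phi j x, forall x, \sum_j phi j x = 1 &
    forall j x, phi j x != 0 -> V j x].
Proof.
move=> oV cV.
have hx (x : X) : exists ju : 'I_q * (X -> R), [/\ continuous ju.2, forall y, 0 <= ju.2 y,
    ju.2 x = 1 & forall y, ju.2 y != 0 -> V ju.1 y].
  have [j _ Vj] : (\bigcup_j V j) x by rewrite cV.
  by have [u hu] := bump (oV j) Vj; exists (j, u).
have [ju hju] := choice hx.
have [s hs] : exists s : seq X, forall y, exists2 x, x \in s & 2^-1 < (ju x).2 y.
  apply: (@finite_cover (fun x => [set y | 2^-1 < (ju x).2 y])) => x.
  have [cu _ u1 _] := hju x.
  have o : open ((ju x).2 @^-1` [set r | 2^-1 < r]) by apply: open_comp => //; exact: open_gt.
  apply: open_nbhs_nbhs; split=> //=.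
  by rewrite u1 invf_lt1 ?ltr1n.
pose psi j y := \sum_(x <- s | (ju x).1 == j) (ju x).2 y.
have psi0 j y : 0 <= psi j y by apply: sumr_ge0 => x _; have [_ h _ _] := hju x.
have cpsi j : continuous (psi j).
  move=> y; apply: cvg_big => [|x _]; first exact: add_continuous.
  by have [cu _ _ _] := hju x; exact: cu.
pose tot y := \sum_j psi j y.
have ctot : continuous tot.
  move=> y; apply: cvg_big => [|j _]; first exact: add_continuous.
  exact: cpsi.
have tot0 y : 0 < tot y.
  have [x xs hxy] := hs y.
  apply: (@lt_le_trans _ _ (psi (ju x).1 y)).
    apply: (@lt_le_trans _ _ ((ju x).2 y)); first by apply: lt_trans hxy; rewrite invr_gt0.
    rewrite /psi (big_rem x) //= eqxx lerDl sumr_ge0 // => z _.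
    by have [_ h _ _] := hju z.
  by rewrite /tot (bigD1 (ju x).1) //= lerDl sumr_ge0.
exists (fun j y => psi j y / tot y); split.
- move=> j y; apply: cvgM; first exact: cpsi.
  by apply: cvgV (ctot y); rewrite gt_eqF.
- by move=> j y; rewrite divr_ge0 // ltW.
- by move=> y; rewrite -mulr_suml -/(tot y) divff ?gt_eqF.
- move=> j y; rewrite mulf_eq0 negb_or => /andP[+ _].
  apply: contraPP => nV; apply/negP; rewrite negbK; apply/eqP.
  apply: big1_seq => x /andP[/eqP jx _].
  apply/eqP; apply: contraT; have [_ _ _ h] := hju x => /h.
  by rewrite jx.
Qed.

End PartitionOfUnity.

(** * The row vectors to be avoided *)

Section Mixtures.
Local Open Scope sesquilinear_scope.
Variable R : realType.
Local Notation C := (Cplx R).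

(** The default value [A] is returned only when [A] is not Hermitian. *)
Definition pospart n (A : 'M[C]_n) : 'M[C]_n := xget A (pos_part_of A).

Lemma pospartP n (A : 'M[C]_n) : A \is hermsymmx -> pos_part_of A (pospart A).
Proof. by move=> /pos_part_ex[P hP]; rewrite /pospart; case: xgetP => [//|/(_ P)]. Qed.

Lemma pos_part_uniq n (A P Q : 'M[C]_n) : pos_part_of A P -> pos_part_of A Q -> P = Q.
Proof.
move=> hP hQ; apply/matrixP => i j; apply/eqP; rewrite -subr_eq0 -normr_le0.
rewrite -(mulr0 n%:R); apply: (pos_part_entry (lexx 0) hP hQ) => a b.
by rewrite subrr normr0.
Qed.

Section Rows.
Variables (n l D1 q p : nat) (g : 'I_q -> 'M[C]_n) (c : R).
Variables (A : 'I_p -> 'M[C]_(l, n)) (B : 'I_p -> 'M[C]_(n, l)).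
Hypothesis hg : forall j, g j \is hermsymmx.

(** [tau] lists the at most [D1.+1] samples active at a point, so that for fixed [tau] the weights
    range over a simplex of dimension [D1]. *)
Definition mixture (tau : 'I_D1.+1 -> 'I_q) (w : 'I_D1.+1 -> R) : 'M[C]_n :=
  \sum_r emb (w r) *: g (tau r) - (emb c)%:M.

Lemma mixture_herm tau w : mixture tau w \is hermsymmx.
Proof.
rewrite /mixture -scaleN1r; apply: hermsymD.
  by apply: hermsym_sum => r; apply: hermsymZ.
have -> : (- 1 : C) = emb (- (1 : R)) by rewrite embN emb1.
by apply: hermsymZ; apply: hermsym_scalar.
Qed.

Definition row_values : set 'rV[C]_n := [set v | exists tau w u i j,
  [/\ forall r, 0 <= w r, \sum_r w r = 1, normalized_at u i,
    near1 (A j *m pospart (mixture tau w) *m B j) &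
    v = u *m A j *m pospart (mixture tau w)]].

(* The parameters below [D1] are the first barycentric coordinates; the following
   [2 (l - 1)] give, rescaled from [[0, 1]] to [[-1, 1]], the real and imaginary
   parts of the coordinates of [u] other than [u 0 i = 1]. *)
Let weight (th : nat -> R) (r : 'I_D1.+1) : R :=
  if (r < D1)%N then th r else 1 - \sum_(r' < D1) th r'.

Let vec (i : 'I_l) (th : nat -> R) : 'rV[C]_l :=
  \row_b if unlift i b is Some b' then
    emb (2 * th (D1 + b'.*2)%N - 1) + ('i : C) * emb (2 * th (D1 + b'.*2.+1)%N - 1)
  else 1.

Lemma weight_param (w : 'I_D1.+1 -> R) (th : nat -> R) : \sum_r w r = 1 ->
  (forall r : 'I_D1.+1, (r < D1)%N -> th r = w r) -> weight th =1 w.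
Proof.
move=> w1 hth r; rewrite /weight; case: ltnP => [/hth//|rD].
have -> : r = ord_max by apply: val_inj => /=; apply/eqP; rewrite eqn_leq rD -ltnS ltn_ord.
move: w1; rewrite big_ord_recr /= => <-; rewrite addrC.
rewrite [X in _ - X](_ : _ = \sum_(r' < D1) w (widen_ord (leqnSn D1) r')) ?addrK //.
by apply: eq_bigr => r' _; rewrite -hth /=.
Qed.

Lemma vec_param (i : 'I_l) (u : 'rV[C]_l) (th : nat -> R) : u 0 i = 1 ->
  (forall b' : 'I_l.-1, th (D1 + b'.*2)%N = (complex.Re (u 0 (lift i b')) + 1) / 2 /\
     th (D1 + b'.*2.+1)%N = (complex.Im (u 0 (lift i b')) + 1) / 2) ->
  vec i th = u.
Proof.
move=> ui hth; apply/rowP => b; rewrite mxE; case: unliftP => [b' ->|->//].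
have [-> ->] := hth b'.
have e (x : R) : 2 * ((x + 1) / 2) - 1 = x by field.
by rewrite !e [RHS]complexE complexiE.
Qed.

Lemma lipb_affine D r : (r < D)%N -> lipb D (fun th : nat -> R => emb (2 * th r - 1)).
Proof.
move=> rD; rewrite (_ : (fun _ => _) =
    (fun th : nat -> R => emb 2 * emb (th r) + - emb 1)); last first.
  by apply/funext => th; rewrite embB embM.
apply: lipbD; last exact: lipb_cst.
by apply: lipbM; [exact: lipb_cst|exact: lipb_coord].
Qed.

Let D := (D1 + 2 * l.-1)%N.

Lemma lip_vec i : lipmx D (vec i).
Proof.
move=> a b; under eq_fun do rewrite mxE.
case: unlift => [b'|]; last exact: lipb_cst.
have := ltn_ord b' => hb'.
apply: lipbD; first by apply: lipb_affine; rewrite /D; lia.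
by apply: lipbM; [exact: lipb_cst|apply: lipb_affine; rewrite /D; lia].
Qed.

Lemma lip_weight r : lipb D (fun th : nat -> R => emb (weight th r)).
Proof.
rewrite /weight; case rD: (r < D1)%N.
  by apply: lipb_coord; rewrite /D; lia.
rewrite (_ : (fun _ => _) =
    (fun th : nat -> R => 1 + \sum_(r' < D1) -1 * emb (th r'))); last first.
  by apply/funext => th; rewrite embB emb1 emb_sum -mulr_sumr mulN1r.
apply: lipbD; first exact: lipb_cst.
apply: lipb_sum => r'.
by apply: lipbM; [exact: lipb_cst|apply: lipb_coord; rewrite /D; have := ltn_ord r'; lia].
Qed.

Lemma lip_mixture tau : lipmx D (fun th => mixture tau (weight th)).
Proof.
move=> a b; under eq_fun do rewrite /mixture mxE summxE.
apply: lipbD; last exact: lipb_cst.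
apply: lipb_sum => r; under eq_fun do rewrite mxE.
by apply: lipbM; [exact: lip_weight|exact: lipb_cst].
Qed.

Lemma row_values_thin : thin D row_values.
Proof.
have [b [b0 hb]] : exists b : C, 0 < b /\ forall j i a, `|B j i a| <= b.
  have hB j := entry_bound (B j); have [bb hbb] := choice hB.
  exists (1 + \sum_j bb j); split=> [|j i a].
    by rewrite ltr_pwDl ?sumr_ge0 // => j _; rewrite ltW //; case: (hbb j).
  apply: (@le_trans _ _ (bb j)); first by case: (hbb j).
  rewrite (bigD1 j) //= addrCA lerDl addr_ge0 // sumr_ge0 // => k _.
  by rewrite ltW //; case: (hbb k).
pose G (t : {ffun 'I_D1.+1 -> 'I_q} * 'I_p * 'I_l) th :=
  vec t.2 th *m A t.1.2 *m pospart (mixture t.1.1 (weight th)).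
exists {: {ffun 'I_D1.+1 -> 'I_q} * 'I_p * 'I_l}, G, (2 * n.+1%:R * b)^-1.
split; first by rewrite invr_gt0 !mulr_gt0.
  move=> t; apply: lipmxM; first by apply: lipmxM; [exact: lip_vec|exact: lipmx_cst].
  by apply: lipmx_pos (lip_mixture t.1.1) => th; apply/pospartP/mixture_herm.
move=> v [tau [w [u [i [j [w0 w1 hu hAB ev]]]]]]; split.
  (* Entry [i] of [v *m B j] has modulus at least [1/2]; as the entries of [B j] are bounded by [b],
     some entry of [v] must be large. *)
  have := near1_row hAB hu; rewrite !mulmxA -ev => hv.
  apply/existsP; apply: contraT; rewrite negb_exists => /forallP hn.
  have {}hn a : `|v 0 a| <= (2 * n.+1%:R * b)^-1.
    have := hn a; rewrite -real_ltNge ?normr_real ?ger0_real ?invr_ge0 ?mulr_ge0 ?(ltW b0) //.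
    exact: ltW.
  have : `|(v *m B j) 0 i| < 2^-1.
    rewrite mxE; apply: le_lt_trans (ler_norm_sum _ _ _) _.
    apply: (@le_lt_trans _ _ (\sum_(a < n) (2 * n.+1%:R * b)^-1 * b)).
      by apply: ler_sum => a _; rewrite normrM ler_pM.
    rewrite sumr_const card_ord -[ltLHS]mulr_natl !invfM mulrA -!mulrA mulVf ?gt_eqF // mulr1.
    rewrite mulrCA gtr_pMr ?invr_gt0 ?ltr0n //.
    by rewrite ltr_pdivrMr ?ltr0n // mul1r ltr_nat.
  by move=> /(le_lt_trans hv); rewrite ltxx.
(* A right inverse of [weight] and [vec]: past [D1], even offsets carry real parts and odd offsets
   imaginary parts. *)
pose th (r : nat) : R := if (r < D1)%N then w (inord r) else
  if (insub (r - D1)./2 : option 'I_l.-1) is Some b' then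
    if odd (r - D1) then (complex.Im (u 0 (lift i b')) + 1) / 2
    else (complex.Re (u 0 (lift i b')) + 1) / 2
  else 0.
exists (finfun tau, j, i), th; split.
  move=> r _; rewrite /th; case: ifP => _.
    by rewrite w0 -w1 (bigD1 (inord r)) //= lerDl sumr_ge0.
  case: insubP => [b' _ _|_]; last by rewrite lexx ler01.
  have [_ /(_ (lift i b'))] := hu; rewrite normc_def -[1]/(emb 1) lecR => hz.
  have {}hz : complex.Re (u 0 (lift i b')) ^+ 2 + complex.Im (u 0 (lift i b')) ^+ 2 <= 1.
    by rewrite -[leLHS]sqr_sqrtr ?addr_ge0 ?sqr_ge0 // exprn_ile1 ?sqrtr_ge0.
  by case: ifP => _; nra.
have hv : vec i th = u.
  apply: vec_param; first by case: hu.
  move=> b'; have lb' := ltn_ord b'.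
  split; rewrite /th ltnNge leq_addr /= addKn.
    by rewrite doubleK odd_double; case: insubP => [b'' _ /val_inj ->|]; rewrite ?lb'.
  by rewrite /= odd_double uphalf_double; case: insubP => [b'' _ /val_inj ->|]; rewrite ?lb'.
have hw : weight th =1 w.
  by apply: weight_param => // r rD; rewrite /th rD inord_val.
rewrite /G /= hv ev; congr (_ *m pospart _); rewrite /mixture; congr (_ - _).
by apply: eq_bigr => r _; rewrite ffunE hw.
Qed.

End Rows.
End Mixtures.

(** * Finite-dimensional approximation *)

Section Approximation.
Local Open Scope sesquilinear_scope.
Variable R : realType.
Local Notation C := (Cplx R).

Lemma pos_lower_bound (T : choiceType) (s : seq T) (e : T -> C) : (forall x, 0 < e x) ->
  exists eta : C, 0 < eta /\ forall x, x \in s -> eta <= e x.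
Proof.
move=> e0; elim: s => [|y s [eta [eta0 h]]]; first by exists 1.
have [le|/ltW le] := real_leP (gtr0_real eta0) (gtr0_real (e0 y)).
  exists eta; split=> // x; rewrite in_cons => /orP[/eqP->//|]; exact: h.
exists (e y); split=> // x; rewrite in_cons => /orP[/eqP->//|/h]; exact: le_trans.
Qed.

(** The support is enumerated and padded with weight [0]. The clause over all [h] transfers both the
    sum of the weights and the weighted sum of matrices. *)
Lemma support_enum q N (phi : 'I_q -> R) : (forall j, 0 <= phi j) -> \sum_j phi j = 1 ->
  (#|[pred j | phi j != 0%R]| <= N)%N ->
  exists (tau : 'I_N -> 'I_q) (w : 'I_N -> R), [/\ forall r, 0 <= w r, \sum_r w r = 1 &
    forall (V : zmodType) (h : R -> 'I_q -> V), (forall j, h 0 j = 0) ->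
      \sum_r h (w r) (tau r) = \sum_j h (phi j) j].
Proof.
move=> phi0 phi1 hN.
have [j0 hj0] : exists j0, phi j0 != 0.
  apply/existsP; apply: contraT; rewrite negb_exists => /forallP h.
  move: phi1; rewrite big1 => [/esym/eqP|j _]; first by rewrite oner_eq0.
  by apply/eqP; rewrite -[_ == _]negbK h.
pose s := enum [pred j | phi j != 0].
have sN : (size s <= N)%N by rewrite -cardE.
pose tau (r : 'I_N) := nth j0 s r.
pose w (r : 'I_N) := if (r < size s)%N then phi (tau r) else 0.
have key (V : zmodType) (h : R -> 'I_q -> V) : (forall j, h 0 j = 0) ->
    \sum_r h (w r) (tau r) = \sum_j h (phi j) j.
  move=> h0; transitivity (\sum_(r < N | (r < size s)%N) h (phi (tau r)) (tau r)).
    rewrite [RHS]big_mkcond; apply: eq_bigr => r _; rewrite /w; case: ifP => // _.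
  rewrite -(big_ord_widen _ (fun r => h (phi (nth j0 s r)) (nth j0 s r)) sN).
  rewrite -(big_mkord predT (fun r => h (phi (nth j0 s r)) (nth j0 s r))).
  rewrite -(big_nth j0 predT (fun j => h (phi j) j)) /s big_enum /=.
  rewrite [RHS](bigID [pred j | phi j != 0]) /= [X in _ = _ + X]big1 ?addr0 //.
  by move=> j; rewrite negbK => /eqP ->.
exists tau, w; split=> //.
- by move=> r; rewrite /w; case: ifP.
- by rewrite (key R (fun x _ => x)).
Qed.

Variable X : topologicalType.
Hypothesis compactX : compact [set: X].

(** Compactness reduces the local rank certificates to finitely many with a common tolerance. Half
    of each radius is spent on moving from [x] to a centre [z], half on moving from [f x] to [y]. *)
Lemma margin n l (f : X -> 'M[C]_n) : continuous f -> (forall x, (l <= \rank (f x))%N) ->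
  exists (eta : C) p (A : 'I_p -> 'M[C]_(l, n)) (B : 'I_p -> 'M[C]_(n, l)), 0 < eta /\
    forall x, exists j, forall y : 'M[C]_n, (forall a b, `|f x a b - y a b| <= eta) ->
      near1 (A j *m y *m B j).
Proof.
move=> cf rf.
have hx x : exists ABe : 'M[C]_(l, n) * 'M[C]_(n, l) * C, 0 < ABe.2 /\
   forall y : 'M[C]_n, (forall a b, `|f x a b - y a b| <= ABe.2) ->
     near1 (ABe.1.1 *m y *m ABe.1.2).
  have [A [B AB]] := rank_factor1 (rf x).
  by have [e he] := near1_open AB; exists (A, B, e).
have [W hW] := choice hx.
have e2 x : 0 < (W x).2 / 2 by rewrite divr_gt0 //; case: (hW x).
have [s hs] := finite_cover compactX (fun x => mx_continuous_near x cf (e2 x)).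
have [eta [eta0 heta]] := pos_lower_bound s e2.
exists eta, (size s), (fun i => (W (tnth (in_tuple s) i)).1.1),
  (fun i => (W (tnth (in_tuple s) i)).1.2); split=> // x.
have [z zs hz] := hs x.
have zi : (index z s < size s)%N by rewrite index_mem.
exists (Ordinal zi) => y hy; rewrite (tnth_nth z) /= nth_index //.
have [_ ] := hW z; apply=> a b.
rewrite -(subrKA (f x a b)) [(W z).2]splitr; apply: le_trans (ler_normD _ _) _.
by apply: lerD; [exact: hz|apply: le_trans (hy a b) (heta z zs)].
Qed.

Hypothesis hausdorffX : hausdorff_space X.

(** A cover by sets on which [f] stays within [e / 2] of a central value is refined to order at most
    [N]; a subordinate partition of unity and one sample point per member do the rest. *)
Lemma finite_approx n (f : X -> 'M[C]_n) (x0 : X) (N : nat) (d : int) (e : C) :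
  covering_dim_le X d -> d + 1 <= N%:Z -> continuous f -> 0 < e ->
  exists q (phi : 'I_q -> X -> R) (xs : 'I_q -> X), [/\ forall j, continuous (phi j),
    forall j x, 0 <= phi j x, forall x, \sum_j phi j x = 1,
    forall x, (#|[pred j | phi j x != 0%R]| <= N)%N &
    forall j x, phi j x != 0 -> forall a b, `|f (xs j) a b - f x a b| <= e].
Proof.
move=> dX dN cf e0; have e2 : 0 < e / 2 by rewrite divr_gt0.
pose V x : set X := [set y | forall a b, `|f x a b - f y a b| <= e / 2].
have hV x : nbhs x (V x)° by apply/nbhs_interior; exact: (mx_continuous_near x cf e2).
have [s hs] := finite_cover compactX hV.
have [|| q [W [oW cW WU Wd]]] := dX (size s) (fun i => (V (tnth (in_tuple s) i))°).
- by move=> i; exact: open_interior.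
- rewrite -subTset => y _; have [z zs hz] := hs y.
  have zi : (index z s < size s)%N by rewrite index_mem.
  by exists (Ordinal zi) => //; rewrite (tnth_nth z) /= nth_index.
have [phi [cphi phi0 phi1 phiW]] := partition_of_unity compactX hausdorffX R oW cW.
(* The point [x0] is the sample only for empty members, whose partition function is [0]. *)
have hxs j : exists x, (W j !=set0 -> W j x).
  have [[x Wx]|nW] := pselect (W j !=set0); first by exists x.
  by exists x0.
have [xs hxs'] := choice hxs.
exists q, phi, xs; split=> // [x|j x /phiW Wx a b].
  rewrite -lez_nat (le_trans _ dN) // (le_trans _ (Wd x)) // lez_nat.
  apply: subset_leq_card; apply/fintype.subsetP => j; rewrite inE => /phiW Wx.
  by rewrite unfold_in /=; exact: mem_set.
have [i Vi] := WU j; have Wxs : W j (xs j) by apply: hxs'; exists x.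
have /interior_subset/(_ a b) h1 := Vi _ Wx.
have /interior_subset/(_ a b) h2 := Vi _ Wxs.
rewrite -(subrKA (f (tnth (in_tuple s) i) a b)) [e]splitr.
by apply: le_trans (ler_normD _ _) _; rewrite distrC; apply: lerD.
Qed.

End Approximation.

(** * The deformation *)

Section Deformation.
Local Open Scope sesquilinear_scope.
Variable R : realType.
Local Notation C := (Cplx R).

(** The form of [E] at [u] is at most [e] times the sum of all products of moduli of two
    coordinates, and the arithmetic-geometric inequality bounds that sum by [n] times the squared
    norm of [u]. *)
Lemma nonneg_scalar_sub n (E : 'M[C]_n) (e : C) : E \is hermsymmx -> 0 <= e ->
  (forall a b, `|E a b| <= e) -> nonneg_definite ((n%:R * e)%:M - E).
Proof.
move=> /hermsymP hE e0 he.
have ne0 : 0 <= n%:R * e by rewrite mulr_ge0.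
split.
  apply/hermsymP; rewrite ctmxB hE tr_scalar_mx map_scalar_mx.
  by congr (_%:M - _); exact: (CrealP (ger0_real ne0)).
move=> u; rewrite mulmxBr mulmxBl mul_mx_scalar -scalemxAl.
have hr : (u *m E *m u^t*) 0 0 \is Num.real.
  apply/CrealP; transitivity ((u *m E *m u^t*)^t* 0 0); first by rewrite !mxE.
  by rewrite !ctmxM trmxCK hE mulmxA.
have -> : (n%:R * e *: (u *m u^t*) - u *m E *m u^t*) 0 0 =
   n%:R * e * (u *m u^t*) 0 0 - (u *m E *m u^t*) 0 0 by rewrite !mxE.
rewrite subr_ge0; apply: le_trans (real_ler_norm hr) _.
rewrite dot_mxE; apply: le_trans (ler_norm_sum _ _ _) _.
apply: (@le_trans _ _ (\sum_i \sum_j e / 2 * (`|u 0 i| ^+ 2 + `|u 0 j| ^+ 2))).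
  apply: ler_sum => i _; rewrite mxE normrM norm_conjC.
  apply: le_trans (ler_wpM2r (normr_ge0 _) (ler_norm_sum _ _ _)) _.
  rewrite mulr_suml; apply: ler_sum => j _; rewrite normrM.
  apply: (@le_trans _ _ (`|u 0 j| * e * `|u 0 i|)).
    by rewrite ler_wpM2r // ler_wpM2l.
  have -> : `|u 0 j| * e * `|u 0 i| = e / 2 * (2 * (`|u 0 i| * `|u 0 j|)).
    by field.
  apply: ler_wpM2l; first by rewrite divr_ge0.
  rewrite -subr_ge0 (_ : _ - _ = (`|u 0 i| - `|u 0 j|) ^+ 2); last by ring.
  by rewrite real_exprn_even_ge0 // rpredB ?normr_real.
have -> : (u *m u^t*) 0 0 = \sum_i `|u 0 i| ^+ 2.
  by rewrite dot_mxE; apply: eq_bigr => i _; rewrite normCK.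
set s := \sum_i `|u 0 i| ^+ 2.
under eq_bigr do rewrite -mulr_sumr big_split /= sumr_const card_ord.
rewrite -mulr_sumr big_split /= sumr_const card_ord -/s sumrMnl -/s.
rewrite -[s *+ n]mulr_natl le_eqVlt; apply/orP; left; apply/eqP; by field.
Qed.

Lemma near1_rank n l (A : 'M[C]_(l, n)) (y : 'M[C]_n) (B : 'M[C]_(n, l)) :
  near1 (A *m y *m B) -> (l <= \rank y)%N.
Proof.
move=> h; apply: (@leq_trans (\rank (A *m y *m B))).
  apply: rank_ge_normalized => u i /(near1_row h); apply: contraTneq => ->.
  by rewrite mxE normr0 -real_ltNge ?real0 ?ger0_real ?invr_ge0 // invr_gt0.
by apply: leq_trans (mxrankM_maxl _ _) _; apply: mxrankM_maxr.
Qed.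

Lemma scale_continuous (T : topologicalType) m n (a : T -> R) (f : T -> 'M[C]_(m, n)) :
  continuous a -> continuous f -> continuous (fun x => emb (a x) *: f x).
Proof.
move=> ca cf x; apply: cvgZ; last exact: cf.
by apply: (comp_continuous ca (@emb_continuous R)).
Qed.

Lemma add_mx_continuous (T : topologicalType) m n (f g : T -> 'M[C]_(m, n)) :
  continuous f -> continuous g -> continuous (fun x => f x + g x).
Proof. by move=> cf cg x; apply: cvgD; [exact: cf|exact: cg]. Qed.

Lemma const_continuous (T U : topologicalType) (c : U) : continuous (fun _ : T => c).
Proof. by move=> x; exact: cvg_cst. Qed.

Lemma Snkl_nonempty n k l : (l <= k)%N -> (k <= n)%N -> Snkl R n k l !=set0.
Proof.
move=> lk kn; pose P : 'M[C]_n := pid_mx l; exists (P *m P^t*).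
split; first exact: gram_nonneg.
by rewrite rank_gram rank_pid_mx ?leqnn // (leq_trans lk).
Qed.

Section Space.
Variables (X : topologicalType) (n k l : nat).
Hypotheses (compactX : compact [set: X]) (hausdorffX : hausdorff_space X).
Hypotheses (l_gt0 : (0 < l)%N) (le_lk : (l <= k)%N).
Local Notation S := (Snkl R n k l).

(* [V] consists of the rows that [M] has to avoid. *)
Lemma deform (f : X -> 'M[C]_n) (x0 : X) (d : int) :
  covering_dim_le X d -> (d %/ 2)%Z <= k%:Z - l%:Z ->
  continuous f -> (forall x, S (f x)) ->
  exists ft V, [/\ linked S f ft, thin (2 * k).-1 V &
    forall M : 'M[C]_(n, k), (forall v, V v -> v *m M != 0) ->
      forall x, (l <= \rank (ft x *m M))%N].
Proof.
move=> dX dkl cf Sf.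
have [|eta [p [A [B [eta0 hAB]]]]] := @margin R X compactX n l f cf.
  by move=> x; have [_ /andP[]] := Sf x.
(* One factor [n.+1] pays for the deviation [e] plus the subtracted scalar [n * e], the other for
   the loss [n] in [pos_part_entry]. *)
pose e : C := eta / (n.+1%:R * n.+1%:R).
have e0 : 0 < e by rewrite divr_gt0 // mulr_gt0.
(* The largest dimension whose half rounds down to [k - l]; with the [2 (l - 1)] parameters of [u]
   the total is [2 k - 1]. *)
pose D1 := (2 * (k - l)).+1.
have dD : d + 1 <= D1.+1%:Z by rewrite /D1; lia.
have [q [phi [xs [cphi phi0 phi1 phiN phif]]]] :=
  finite_approx compactX hausdorffX x0 dX dD cf e0.
have hf x : f x \is hermsymmx by have [[]] := Sf x.
pose g j := f (xs j).
pose c : R := complex.Re (n%:R * e).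
have cE : emb c = n%:R * e by apply/RRe_real/ger0_real; rewrite mulr_ge0 // ltW.
pose F x := \sum_j emb (phi j x) *: g j.
have hF x : F x \is hermsymmx by apply: hermsym_sum => j; apply/hermsymZ/hf.
have Ff x a b : `|F x a b - f x a b| <= e.
  have -> : F x a b - f x a b = \sum_j emb (phi j x) * (g j a b - f x a b).
    under eq_bigr do rewrite mulrBr.
    rewrite sumrB -mulr_suml -emb_sum phi1 emb1 mul1r /F summxE.
    by congr (_ - _); apply: eq_bigr => j _; rewrite mxE.
  apply: le_trans (ler_norm_sum _ _ _) _.
  apply: (@le_trans _ _ (\sum_j emb (phi j x) * e)); last first.
    by rewrite -mulr_suml -emb_sum phi1 emb1 mul1r.
  apply: ler_sum => j _; rewrite normrM ger0_norm ?emb_ge0 //.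
  have [->|pj] := eqVneq (phi j x) 0; first by rewrite /emb !mul0r.
  by rewrite ler_wpM2l ?emb_ge0 //; apply: phif.
pose E x := F x - f x.
have hE x : E x \is hermsymmx.
  by apply/hermsymP; rewrite ctmxB (hermsymP _ (hF x)) (hermsymP _ (hf x)).
(* The entries of [E x] are at most [e], so subtracting [n * e] makes [N x] nonpositive; [f + t N]
   then stays below [f], which bounds the rank of its positive part. *)
pose N x := E x - (emb c)%:M.
have negN x : nonneg_definite (- N x).
  rewrite opprB cE; apply: nonneg_scalar_sub; [exact: hE|exact: ltW|].
  by move=> a b; rewrite !mxE; apply: Ff.
have hN x : N x \is hermsymmx.
  have [/hermsymP h _] := negN x.
  by apply/hermsymP; rewrite -[N x]opprK -scaleN1r ctmxZ h rmorphN rmorph1.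
pose Z (z : X * R) := f z.1 + emb z.2 *: N z.1.
have hZ z : pos_part_of (Z z) (pospart (Z z)).
  by apply/pospartP/hermsymD; [exact: hf|apply: hermsymZ].
have cF : continuous F.
  move=> x; apply: cvg_big => [|j _]; first exact: add_continuous.
  by apply: scale_continuous; [exact: cphi|exact: (@const_continuous _ _ (g j))].
have cE' : continuous E by move=> x; apply: cvgB; [exact: cF|exact: cf].
have cN : continuous N by move=> x; apply: cvgB; [exact: cE'|exact: cvg_cst].
have cZ : continuous Z.
  apply: add_mx_continuous; first exact: comp_continuous (@fst_continuous _ _) cf.
  apply: scale_continuous; first exact: snd_continuous.
  exact: comp_continuous (@fst_continuous _ _) cN.
have hclose x t : 0 <= t <= 1 -> forall a b, `|f x a b - pospart (Z (x, t)) a b| <= eta.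
  move=> /andP[t0 t1] a b.
  have en0 : 0 <= n.+1%:R * e by rewrite mulr_ge0 // ltW.
  apply: le_trans (pos_part_entry en0 (pos_part_id (proj1 (Sf x))) (hZ (x, t)) _ a b) _.
    move=> a' b'.
    rewrite /Z /= mxE opprD addrA subrr sub0r normrN mxE normrM ger0_norm ?emb_ge0 //.
    apply: (@le_trans _ _ (1 * `|N x a' b'|)).
      by rewrite ler_wpM2r // (lecR t 1).
    rewrite mul1r /N !mxE; apply: le_trans (ler_normB _ _) _.
    rewrite -natr1 mulrDl mul1r [leRHS]addrC lerD ?Ff //.
    have /= -> : `|emb c *+ (a' == b')| = (n%:R * e) *+ (a' == b').
      by rewrite cE normrMn ger0_norm // mulr_ge0 // ltW.
    by case: (_ == _); rewrite ?mulr1n // mulr0n mulr_ge0 // ltW.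
  have n1 : n.+1%:R != 0 :> C by rewrite pnatr_eq0.
  have -> : n%:R * (n.+1%:R * e) = eta * (n%:R / n.+1%:R) by rewrite /e; field.
  by rewrite ler_piMr ?(ltW eta0) // ler_pdivrMr ?ltr0n // mul1r ler_nat.
have rk x t : 0 <= t <= 1 -> exists j, near1 (A j *m pospart (Z (x, t)) *m B j).
  move=> t01; have [j hj] := hAB x; exists j; apply: hj => a b; exact: hclose.
exists (fun x => pospart (Z (x, 1))), (row_values D1 g c A B); split.
- exists (fun z => pospart (Z z)); split.
  + by apply: pos_part_continuous cZ.
  + move=> x t t01; split; first by case: (hZ (x, t)).
    have [j /near1_rank ->] := rk x t t01; rewrite andTb.
    have [Px /andP[_ rx]] := Sf x; apply: leq_trans rx.
    apply: pos_part_rank (hZ (x, t)) Px _.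
    rewrite /Z /= opprD addrA subrr sub0r -scalerN; apply: nonnegZ => //.
    by rewrite emb_ge0; case/andP: t01.
  + move=> x; apply: pos_part_uniq (hZ _) _; rewrite /Z /= /emb scale0r addr0.
    by apply: pos_part_id; case: (Sf x).
  + by [].
- have -> : (2 * k).-1 = (D1 + 2 * l.-1)%N by rewrite /D1; lia.
  by apply: row_values_thin => j; apply: hf.
- move=> M hM x; have [j hj] := rk x 1 ltac:(by rewrite ler01 lexx).
  apply: leq_trans (mxrankM_maxr (A j) _).
  apply: rank_ge_normalized => u i hu; rewrite !mulmxA; apply: hM.
  have [tau [w [w0 w1 hw]]] := support_enum (fun j => phi0 j x) (phi1 x) (phiN x).
  have eZ : Z (x, 1) = mixture g c tau w.
    rewrite /Z /= emb1 scale1r /N /E addrA [f x + _]addrC subrK /mixture; congr (_ - _).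
    rewrite (hw _ (fun r j => emb r *: g j)) // => j'.
    by rewrite /emb scale0r.
  by exists tau, w, u, i, j; rewrite -eZ.
Qed.

Lemma finish (f : X -> 'M[C]_n) (M : 'M[C]_(n, k)) : continuous f ->
  (forall x, S (f x)) -> (forall x, (l <= \rank (f x *m M))%N) ->
  linked S f (fun=> M *m M^t*).
Proof.
move=> cf Sf rM; have hf x : (f x)^t* = f x by have [[/hermsymP]] := Sf x.
have gramE x : f x *m (M *m M^t*) *m f x = (f x *m M) *m (f x *m M)^t*.
  by rewrite ctmxM hf !mulmxA.
have G x : nonneg_definite (f x *m (M *m M^t*) *m f x).
  by rewrite gramE; exact: gram_nonneg.
have cst0 (t : R) : 0 < t -> emb t != 0 :> C by move=> t0; rewrite gt_eqF // (ltcR 0 t).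
have c1t : continuous (fun z : X * R => 1 - z.2).
  by move=> z; apply: cvgB; [exact: cvg_cst|exact: cvg_snd].
have cM := @const_continuous (X * R)%type _ (M *m M^t*).
have cf1 := comp_continuous (@fst_continuous X R) cf.
apply: (@linked_trans _ _ _ _ _ _ (fun x => f x *m (M *m M^t*) *m f x)).
  exists (fun z => emb (1 - z.2) *: f z.1 + emb z.2 *: (f z.1 *m (M *m M^t*) *m f z.1)).
  split.
  - apply: add_mx_continuous; first exact: scale_continuous.
    apply: scale_continuous; first exact: snd_continuous.
    exact: (mx_continuousM (mx_continuousM cf1 cM) cf1).
  - move=> x t /andP[t0 t1] /=; have [Px /andP[lx xk]] := Sf x.
    have et : 0 <= emb t :> C by rewrite emb_ge0.
    have e1t : 0 <= emb (1 - t) :> C by rewrite emb_ge0 subr_ge0.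
    have P1 := nonnegZ e1t Px; have P2 := nonnegZ et (G x).
    split; first exact: (nonnegD P1 P2).
    apply/andP; split; last first.
      (* Both terms have [f x] as left factor, so the rank of the sum is at most that of [f x]. *)
      rewrite -mulmxA [_ *: f x](_ : _ = f x *m (emb (1 - t))%:M); last by rewrite mul_mx_scalar.
      by rewrite scalemxAr -mulmxDr; apply: leq_trans (mxrankM_maxl _ _) xk.
    move: t0; rewrite le_eqVlt => /orP[/eqP<-|t0].
      by rewrite subr0 /emb scale0r addr0 -/(emb 1) emb1 scale1r.
    rewrite addrC; apply: leq_trans (rankD_nonneg P2 P1).
    by rewrite (eqmx_scale _ (cst0 _ t0)) gramE rank_gram.
  - by move=> x /=; rewrite subr0 emb1 scale1r /emb scale0r addr0.
  - by move=> x /=; rewrite subrr emb1 scale1r /emb scale0r add0r.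
pose Bt (z : X * R) := emb z.2 *: 1%:M + emb (1 - z.2) *: f z.1.
have cB : continuous Bt.
  apply: add_mx_continuous; last exact: scale_continuous.
  by apply: scale_continuous; [exact: snd_continuous|exact: (@const_continuous _ _ (1%:M : 'M[C]_n))].
have B0 x : Bt (x, 0) = f x by rewrite /Bt /= /emb scale0r add0r subr0 -/(emb 1) emb1 scale1r.
have B1 x : Bt (x, 1) = 1%:M by rewrite /Bt /= emb1 scale1r subrr /emb scale0r addr0.
have Bh x t : (Bt (x, t))^t* = Bt (x, t).
  rewrite /Bt /= ctmxD !ctmxZ hf trmx1 map_mx1.
  by rewrite !(CrealP (emb_real _)).
exists (fun z => Bt z *m (M *m M^t*) *m Bt z); split.
- exact: (mx_continuousM (mx_continuousM cB cM) cB).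
- move=> x t /andP[t0 t1] /=; have [Px /andP[lx xk]] := Sf x.
  have -> : Bt (x, t) *m (M *m M^t*) *m Bt (x, t) = (Bt (x, t) *m M) *m (Bt (x, t) *m M)^t*.
    by rewrite ctmxM Bh !mulmxA.
  split; first exact: gram_nonneg.
  (* The number of columns of [M] gives the upper bound [k]. At time [0] the lower bound is the
     hypothesis on [f x *m M]; afterwards [Bt] is invertible and the rank is that of [M]. *)
  rewrite rank_gram rank_leq_col andbT.
  move: t0; rewrite le_eqVlt => /orP[/eqP<-|t0]; first by rewrite B0.
  have full : row_full (Bt (x, t)).
    rewrite /row_full eqn_leq rank_leq_col /=.
    apply: (@leq_trans (\rank (1%:M : 'M[C]_n))); first by rewrite mxrank1.
    apply: rank_le_ker => u uB.
    have et : 0 <= emb t :> C by rewrite emb_ge0 ltW.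
    have e1t : 0 <= emb (1 - t) :> C by rewrite emb_ge0 subr_ge0.
    have /eqP := nonneg_kerD (nonnegZ et (nonneg1 R n)) (nonnegZ e1t Px) uB.
    by rewrite -scalemxAr scaler_eq0 (negbTE (cst0 _ t0)) => /eqP.
  by rewrite (eqmxMfull _ full); exact: leq_trans (rM x) (mxrankM_maxr (f x) M).
- by move=> x; rewrite B0.
- by move=> x; rewrite B1 mul1mx mulmx1.
Qed.

Lemma linked_all (f g : X -> 'M[C]_n) (d : int) :
  covering_dim_le X d -> (d %/ 2)%Z <= k%:Z - l%:Z ->
  continuous f -> continuous g -> (forall x, S (f x)) -> (forall x, S (g x)) ->
  linked S f g.
Proof.
move=> dX dkl cf cg Sf Sg.
(* [deform] takes a sample point, so the empty space is treated apart. *)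
have [[x0 _]|nX] := pselect (exists x : X, True); last first.
  have noX (x : X) : False by apply: nX; exists x.
  exists (fun z => f z.1).
  by split=> [z|x|x|x]; [case: (noX z.1)|case: (noX x)|reflexivity|case: (noX x)].
have [ft [V [fft tV Vf]]] := deform x0 dX dkl cf Sf.
have [gt [W [ggt tW Wg]]] := deform x0 dX dkl cg Sg.
have Dk : ((2 * k).-1 < 2 * k)%N by lia.
have [M hM] := thin_avoid Dk (thinU tV tW).
have Mf x : (l <= \rank (ft x *m M))%N by apply: Vf => v Vv; apply: hM; left.
have Mg x : (l <= \rank (gt x *m M))%N by apply: Wg => v Wv; apply: hM; right.
have end_in (f1 f2 : X -> 'M[C]_n) : linked S f1 f2 -> forall x, S (f2 x).
  by move=> [H [_ HS _ H1]] x; rewrite -H1; apply: HS; rewrite ler01 lexx.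
have [_ cft] := linked_continuous fft; have [_ cgt] := linked_continuous ggt.
have Lf := finish cft (end_in _ _ fft) Mf.
have Lg := finish cgt (end_in _ _ ggt) Mg.
exact: (linked_trans (linked_trans fft Lf) (linked_sym (linked_trans ggt Lg))).
Qed.

End Space.
End Deformation.

Theorem theorem3p5 (R : realType) (n k l : nat)
    (l_gt0 : (0 < l)%N) (le_lk : (l <= k)%N) (le_kn : (k <= n)%N)
    (X : topologicalType)
    (compactX : compact [set: X]) (hausdorffX : hausdorff_space X)
    (d : int) (dimX : covering_dim X d)
    (le_dim : (d %/ 2)%Z <= k%:Z - l%:Z) :
  let CXS : set {uniform X -> 'M[Cplx R]_n} :=
    continuous_maps (Snkl R n k l) in
  (CXS !=set0 /\
   forall f g, CXS f -> CXS g -> homotopic_in R (Snkl R n k l) f g) /\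
  path_connected R CXS.
Proof.
move=> CXS; have [_ dX _] := dimX.
have link f g : CXS f -> CXS g -> linked (Snkl R n k l) f g.
  move=> [cf Sf] [cg Sg]; exact: (linked_all compactX hausdorffX l_gt0 le_lk dX le_dim cf cg Sf Sg).
have ne : CXS !=set0.
  have [P hP] := Snkl_nonempty R le_lk le_kn.
  by exists (fun=> P); split=> //; exact: const_continuous.
split; first by split=> // f g hf hg; apply/linked_homotopic/link.
split=> // f g hf hg; exact: linked_path compactX (link f g hf hg).
Qed.
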